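(* Let $u,v\in S_n$. The Castelnuovo--Mumford polynomials $\mathfrak{CM}_u(\mathbf x)$ and $\mathfrak{CM}_v(\mathbf x)$ agree up to a nonzero scalar multiple if and only if $\mathrm{rajcode}(u)=\mathrm{rajcode}(v)$.
   Context: Permutations $w\in S_n$ are written in one-line notation $w(1)\cdots w(n)$; $ws_i$ is $w$ with the entries in positions $i,i+1$ switched, $s_i=(i\ i+1)$. $\mathrm{inv}(w)$ is the number of pairs $i<j$ with $w(i)>w(j)$. $w_0=n(n-1)\cdots1$. Rajchgot code: for each $k$, take an increasing subsequence of $w(k)\cdots w(n)$ that contains $w(k)$ and has greatest length among such; $r_k$ is the number of terms of $w(k)\cdots w(n)$ omitted from it. $\mathrm{rajcode}(w)=(r_1,\dots,r_n)$. Grothendieck polynomials: on $\mathbb Z[x_1,\dots,x_n]$ let $s_i$ act by exchanging $x_i$ and $x_{i+1}$, $\partial_i(f)=\frac{f-s_i\cdot f}{x_i-x_{i+1}}$, $\overline{\partial}_i(f)=\partial_i((1-x_{i+1})f)$. The $\mathfrak G_w(\mathbf x)$ are determined by $\mathfrak G_{w_0}(\mathbf x)=\prod_{i=1}^n x_i^{n-i}$ and $\overline{\partial}_i\mathfrak G_w(\mathbf x)=\mathfrak G_{ws_i}(\mathbf x)$ whenever $\mathrm{inv}(ws_i)<\mathrm{inv}(w)$. $\mathfrak{CM}_w(\mathbf x)$ is the highest-degree homogeneous part of $(-1)^{\deg\mathfrak G_w(\mathbf x)-\mathrm{inv}(w)}\mathfrak G_w(\mathbf x)$. Scalars are rational numbers.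 *)

(* Defs.v *)
From HB Require Import structures.
From mathcomp Require Import all_boot all_order all_algebra all_fingroup.
From mathcomp Require Import fraction ring zify.
From mathcomp Require Export mpoly.

Set Implicit Arguments.
Unset Strict Implicit.
Unset Printing Implicit Defensive.

Import GRing.Theory.
Local Open Scope ring_scope.

(* Positions and values of w(1)...w(n) are both shifted to 0, ..., n-1.      *)

Section Permutations.
Variable n : nat.
Implicit Types (w : 'S_n) (i j k : 'I_n).

Definition adjacent i j : bool := (j == i.+1 :> nat).

(* The product of 'S_n applies its left factor first, so                     *)
(* (tperm i j * w) x = w (tperm i j x): this is w with the entries in        *)
(* positions i and j switched.                                               *)
Definition swap_pos i j w : 'S_n := (tperm i j * w)%g.

Definition inv w : nat :=
  #|[set p : 'I_n * 'I_n | (p.1 < p.2)%N && (w p.2 < w p.1)%N]|.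

Definition w0 : 'S_n := perm (@rev_ord_inj n).

(* A subsequence of w(k)...w(n) is given by its set S of positions.          *)
Definition incr_from w k (S : {set 'I_n}) : bool :=
  [&& k \in S, [forall i in S, (k <= i)%N]
    & [forall i in S, forall j in S, (i < j)%N ==> (w i < w j)%N]].

(* n - k is the length of the suffix, as k counts from 0.                    *)
Definition raj w k : nat :=
  (n - k - \max_(S : {set 'I_n} | incr_from w k S) #|S|)%N.

Definition rajcode w : n.-tuple nat := [tuple raj w k | k < n].

End Permutations.

Section DividedDifferences.
Variables (n : nat) (R : idomainType).
Implicit Types (f g : {mpoly R[n]}) (i j : 'I_n).

Lemma divdiff_exists i j f :
  exists g, ('X_i - 'X_j) * g == f - msym (tperm i j) f.
Proof.
suff [g ->] : exists g, f - msym (tperm i j) f = ('X_i - 'X_j) * g by exists g.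
pose P f := exists g, f - msym (tperm i j) f = ('X_i - 'X_j) * g.
have PM f1 f2 : P f1 -> P f2 -> P (f1 * f2).
  move=> [g1 e1] [g2 e2]; exists (g1 * f2 + msym (tperm i j) f1 * g2).
  rewrite mulrDr mulrA -e1 mulrCA -e2 msymM; ring.
have PXn k m : P ('X_k ^+ m).
  elim: m => [|m IH].
    by exists 0; rewrite expr0 msym1 subrr mulr0.
  rewrite exprS; apply: PM => //.
  rewrite /P /msym mmapX mmap1U.
  case: tpermP => [->|->|_ _].
  - by exists 1; rewrite mulr1.
  - by exists (-1); rewrite mulrN1 opprB.
  - by exists 0; rewrite subrr mulr0.
have PX m : P 'X_[m].
  rewrite mpolyXE_id; elim/big_ind: _ => //.
  by exists 0; rewrite msym1 subrr mulr0.
elim/mpolyind: f => [|c m f _ _ [g e]].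
  by exists 0; rewrite msym0 subrr mulr0.
have [h eh] := PX m; exists (c *: h + g).
by rewrite msymD msymZ mulrDr -scalerAr -e -eh scalerBr opprD addrACA.
Qed.

Definition divdiff i j f : {mpoly R[n]} := xchoose (divdiff_exists i j f).

Lemma divdiffE i j f :
  ('X_i - 'X_j) * divdiff i j f = f - msym (tperm i j) f.
Proof. exact/eqP/(xchooseP (divdiff_exists i j f)). Qed.

Lemma mpolyX_sub_neq0 i j : i != j -> 'X_i - 'X_j != 0 :> {mpoly R[n]}.
Proof.
move=> ij; rewrite subr_eq0; apply/eqP => /(congr1 (mcoeff U_(i))).
rewrite !mcoeffXU eqxx eq_sym (negbTE ij) => /eqP.
by rewrite oner_eq0.
Qed.

Lemma divdiff_unique i j f g : i != j ->
  ('X_i - 'X_j) * g = f - msym (tperm i j) f -> g = divdiff i j f.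
Proof.
by move=> ij; rewrite -divdiffE => /mulfI; apply; apply: mpolyX_sub_neq0.
Qed.

Definition idivdiff i j f : {mpoly R[n]} := divdiff i j ((1 - 'X_j) * f).

End DividedDifferences.

Lemma msymXU n (R : nzRingType) (s : 'S_n) (k : 'I_n) :
  msym s ('X_k : {mpoly R[n]}) = 'X_(s k).
Proof. by rewrite /msym mmapX mmap1U. Qed.

Lemma idivdiffE n (R : idomainType) (i j : 'I_n) (f : {mpoly R[n]}) :
  ('X_i - 'X_j) * idivdiff i j f =
  (1 - 'X_j) * f - (1 - 'X_i) * msym (tperm i j) f.
Proof.
rewrite /idivdiff divdiffE msymM msymB msym1.
by rewrite msymXU tpermR.
Qed.

Lemma tpermJ3 n (a b c : 'I_n) : a != b -> a != c -> b != c ->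
  (tperm a b * tperm b c * tperm a b = tperm b c * tperm a b * tperm b c)%g.
Proof.
move=> ab ac bc.
have -> : (tperm a b * tperm b c * tperm a b)%g = (tperm b c ^ tperm a b)%g.
  by rewrite /conjg tpermV mulgA.
have -> : (tperm b c * tperm a b * tperm b c)%g = (tperm a b ^ tperm b c)%g.
  by rewrite /conjg tpermV mulgA.
by rewrite !tpermJ tpermR tpermL (tpermD ac bc) tpermD // eq_sym.
Qed.

Lemma braid_field (F : fieldType)
    (x y z f f1 f2 f12 f21 f121 g h k g' h' k' p q r p' q' r' : F) :
  x - y != 0 -> x - z != 0 -> y - z != 0 ->
  (x - y) * g = (1 - y) * f - (1 - x) * f1 ->
  (x - z) * h = (1 - z) * f2 - (1 - x) * f12 ->
  (y - z) * k = (1 - z) * f21 - (1 - y) * f121 ->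
  (y - z) * p = (1 - z) * g - (1 - y) * h ->
  (x - z) * q = (1 - z) * g - (1 - x) * k ->
  (x - y) * r = (1 - y) * p - (1 - x) * q ->
  (y - z) * g' = (1 - z) * f - (1 - y) * f2 ->
  (x - z) * h' = (1 - z) * f1 - (1 - x) * f21 ->
  (x - y) * k' = (1 - y) * f12 - (1 - x) * f121 ->
  (x - y) * p' = (1 - y) * g' - (1 - x) * h' ->
  (x - z) * q' = (1 - z) * g' - (1 - x) * k' ->
  (y - z) * r' = (1 - z) * p' - (1 - y) * q' ->
  r = r'.
Proof.
move=> xy xz yz.
have S (u v w : F) : u != 0 -> u * v = w -> v = w / u.
  by move=> u0 <-; rewrite mulrC mulKf.
move=> /(S _ _ _ xy) -> /(S _ _ _ xz) -> /(S _ _ _ yz) ->.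
move=> /(S _ _ _ yz) -> /(S _ _ _ xz) -> /(S _ _ _ xy) ->.
move=> /(S _ _ _ yz) -> /(S _ _ _ xz) -> /(S _ _ _ xy) ->.
move=> /(S _ _ _ xy) -> /(S _ _ _ xz) -> /(S _ _ _ yz) ->.
field.
by rewrite xy xz yz.
Qed.

Lemma tofrac_rel (R : idomainType) (x y p q f g h : R) :
  (x - y) * h = (1 - p) * f - (1 - q) * g ->
  (tofrac x - tofrac y) * tofrac h =
  (1 - tofrac p) * tofrac f - (1 - tofrac q) * tofrac g.
Proof.
by rewrite -tofrac1 -!tofracB -!tofracM -tofracB => ->.
Qed.

Lemma braid_idomain (F : idomainType)
    (x y z f f1 f2 f12 f21 f121 g h k g' h' k' p q r p' q' r' : F) :
  x - y != 0 -> x - z != 0 -> y - z != 0 ->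
  (x - y) * g = (1 - y) * f - (1 - x) * f1 ->
  (x - z) * h = (1 - z) * f2 - (1 - x) * f12 ->
  (y - z) * k = (1 - z) * f21 - (1 - y) * f121 ->
  (y - z) * p = (1 - z) * g - (1 - y) * h ->
  (x - z) * q = (1 - z) * g - (1 - x) * k ->
  (x - y) * r = (1 - y) * p - (1 - x) * q ->
  (y - z) * g' = (1 - z) * f - (1 - y) * f2 ->
  (x - z) * h' = (1 - z) * f1 - (1 - x) * f21 ->
  (x - y) * k' = (1 - y) * f12 - (1 - x) * f121 ->
  (x - y) * p' = (1 - y) * g' - (1 - x) * h' ->
  (x - z) * q' = (1 - z) * g' - (1 - x) * k' ->
  (y - z) * r' = (1 - z) * p' - (1 - y) * q' ->
  r = r'.
Proof.
move=> xy xz yz; rewrite -tofrac_eq0 tofracB in xy; rewrite -tofrac_eq0 tofracB in xz.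
rewrite -tofrac_eq0 tofracB in yz.
move=> e1 e2 e3 e4 e5 e6 e1' e2' e3' e4' e5' e6'.
apply/eqP; rewrite -tofrac_eq; apply/eqP.
exact: (braid_field xy xz yz
  (tofrac_rel e1) (tofrac_rel e2) (tofrac_rel e3)
  (tofrac_rel e4) (tofrac_rel e5) (tofrac_rel e6)
  (tofrac_rel e1') (tofrac_rel e2') (tofrac_rel e3')
  (tofrac_rel e4') (tofrac_rel e5') (tofrac_rel e6')).
Qed.

Lemma comm_idomain (F : idomainType)
    (x y z t g g1 g2 g12 h k r h' k' r' : F) :
  x - y != 0 -> z - t != 0 ->
  (x - y) * h = (1 - y) * g - (1 - x) * g1 ->
  (x - y) * k = (1 - y) * g2 - (1 - x) * g12 ->
  (z - t) * r = (1 - t) * h - (1 - z) * k ->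
  (z - t) * h' = (1 - t) * g - (1 - z) * g2 ->
  (z - t) * k' = (1 - t) * g1 - (1 - z) * g12 ->
  (x - y) * r' = (1 - y) * h' - (1 - x) * k' -> r = r'.
Proof.
move=> xy zt E1 E2 E3 E1' E2' E3'; apply: (mulfI xy); apply: (mulfI zt).
rewrite mulrCA E3 [RHS](congr1 ( *%R (z - t)) E3') !mulrBr.
rewrite !(mulrCA (x - y)) !(mulrCA (z - t)).
by rewrite E1 E2 E1' E2'; ring.
Qed.

Section Braid.
Variables (n : nat) (R : idomainType).
Implicit Types (f : {mpoly R[n]}) (a b c d : 'I_n).

Lemma msym_idivdiff a b f : a != b ->
  msym (tperm a b) (idivdiff a b f) = idivdiff a b f.
Proof.
move=> ab; apply: (mulfI (mpolyX_sub_neq0 R ab)).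
have /(congr1 (msym (tperm a b))) := idivdiffE a b f.
rewrite !(msymM, msymB, msym1, msymXU) tpermL tpermR -msymMm tperm2 msym1m.
rewrite idivdiffE => e.
by rewrite -[LHS]opprK -mulNr opprB e opprB.
Qed.

Lemma braid_rel a b c f g p r g' p' r' : a != b -> a != c -> b != c ->
  ('X_a - 'X_b) * g = (1 - 'X_b) * f - (1 - 'X_a) * msym (tperm a b) f ->
  msym (tperm a b) g = g ->
  ('X_b - 'X_c) * p = (1 - 'X_c) * g - (1 - 'X_b) * msym (tperm b c) g ->
  ('X_a - 'X_b) * r = (1 - 'X_b) * p - (1 - 'X_a) * msym (tperm a b) p ->
  ('X_b - 'X_c) * g' = (1 - 'X_c) * f - (1 - 'X_b) * msym (tperm b c) f ->
  msym (tperm b c) g' = g' ->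
  ('X_a - 'X_b) * p' = (1 - 'X_b) * g' - (1 - 'X_a) * msym (tperm a b) g' ->
  ('X_b - 'X_c) * r' = (1 - 'X_c) * p' - (1 - 'X_b) * msym (tperm b c) p' ->
  r = r'.
Proof.
move=> ab ac bc; have [ba ca cb] : [/\ b != a, c != a & c != b].
  by rewrite !(eq_sym _ a) (eq_sym c).
move=> e1 gA e4 e6 e1' gB e4' e6'.
have XX := (msymM, msymB, msym1, msymXU).
have TT := (tpermL, tpermR, tpermD ac bc, tpermD ba ca).
have e2 := congr1 (msym (tperm b c)) e1; rewrite !XX !TT in e2.
have e3 := congr1 (msym (tperm a b)) e2; rewrite !XX !TT in e3.
have e5 := congr1 (msym (tperm a b)) e4; rewrite !XX !TT gA in e5.
have e2' := congr1 (msym (tperm a b)) e1'; rewrite !XX !TT in e2'.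
have e3' := congr1 (msym (tperm b c)) e2'; rewrite !XX !TT in e3'.
have e5' := congr1 (msym (tperm b c)) e4'; rewrite !XX !TT gB in e5'.
have eABA : msym (tperm b c) (msym (tperm a b) (msym (tperm b c) f)) =
            msym (tperm a b) (msym (tperm b c) (msym (tperm a b) f)).
  by rewrite -!msymMm !mulgA tpermJ3.
rewrite eABA in e3'.
exact: (braid_idomain (mpolyX_sub_neq0 R ab) (mpolyX_sub_neq0 R ac)
  (mpolyX_sub_neq0 R bc) e1 e2 e3 e4 e5 e6 e1' e2' e3' e4' e5' e6').
Qed.

Lemma idivdiff_braid a b c f : a != b -> a != c -> b != c ->
  idivdiff a b (idivdiff b c (idivdiff a b f)) =
  idivdiff b c (idivdiff a b (idivdiff b c f)).
Proof.
move=> ab ac bc.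
exact: (braid_rel ab ac bc
  (idivdiffE a b f) (msym_idivdiff f ab) (idivdiffE b c (idivdiff a b f))
  (idivdiffE a b (idivdiff b c (idivdiff a b f)))
  (idivdiffE b c f) (msym_idivdiff f bc) (idivdiffE a b (idivdiff b c f))
  (idivdiffE b c (idivdiff a b (idivdiff b c f)))).
Qed.

Lemma idivdiff_comm a b c d f : uniq [:: a; b; c; d] ->
  idivdiff a b (idivdiff c d f) = idivdiff c d (idivdiff a b f).
Proof.
rewrite /= !inE !negb_or => /and4P[/and3P[ab ac ad] /andP[bc bd] cd _].
have [ca da cb db] : [/\ c != a, d != a, c != b & d != b].
  by rewrite !(eq_sym _ a) !(eq_sym _ b).
move: (idivdiffE a b f) (idivdiffE c d (idivdiff a b f))
  (idivdiffE c d f) (idivdiffE a b (idivdiff c d f)).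
move: (idivdiff c d (idivdiff a b f)) (idivdiff a b f) => r g.
move: (idivdiff a b (idivdiff c d f)) (idivdiff c d f) => r' g'.
move=> e1 e3 e1' e3'.
have XX := (msymM, msymB, msym1, msymXU).
have TT := (tpermD ac bc, tpermD ad bd, tpermD ca da, tpermD cb db).
have e2 := congr1 (msym (tperm c d)) e1; rewrite !XX !TT in e2.
have e2' := congr1 (msym (tperm a b)) e1'; rewrite !XX !TT in e2'.
have eAC : msym (tperm c d) (msym (tperm a b) f) =
           msym (tperm a b) (msym (tperm c d) f).
  rewrite -!msymMm; congr (msym _ f).
  by rewrite conjgC tpermJ !tpermD // eq_sym.
rewrite eAC in e2.
exact/esym/(comm_idomain (mpolyX_sub_neq0 R ab) (mpolyX_sub_neq0 R cd)
  e1 e2 e3 e1' e2' e3').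
Qed.

End Braid.

Section Inversions.
Variable n : nat.
Implicit Types (w : 'S_n) (i j k : 'I_n).

Lemma adjacent_neq i j : adjacent i j -> i != j.
Proof. by rewrite /adjacent -val_eqE /=; lia. Qed.

Lemma swap_posL i j w : swap_pos i j w i = w j.
Proof. by rewrite /swap_pos permM tpermL. Qed.

Lemma swap_posR i j w : swap_pos i j w j = w i.
Proof. by rewrite /swap_pos permM tpermR. Qed.

Lemma swap_posD i j w k : i != k -> j != k -> swap_pos i j w k = w k.
Proof. by move=> ik jk; rewrite /swap_pos permM tpermD. Qed.

Lemma swap_posK i j : involutive (swap_pos i j).
Proof. by move=> w; rewrite /swap_pos mulgA tperm2 mul1g. Qed.

Lemma invE w :
  inv w = (\sum_(p : 'I_n * 'I_n | (p.1 < p.2)%N) (w p.2 < w p.1)%N)%N.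
Proof.
rewrite /inv -sum1dep_card big_mkcondr /=; apply: eq_bigr => p _.
by case: (w p.2 < w p.1)%N.
Qed.

Lemma inv_swap_pos i j w : adjacent i j -> (w i < w j)%N ->
  inv (swap_pos i j w) = (inv w).+1.
Proof.
move=> adj wij; have ltij : (i < j)%N by rewrite (eqP adj).
rewrite !invE (bigD1 (i, j)) //= swap_posL swap_posR wij.
rewrite [in RHS](bigD1 (i, j)) //= ltnNge (ltnW wij) /= add0n add1n.
congr _.+1.
pose h (p : 'I_n * 'I_n) := (tperm i j p.1, tperm i j p.2).
have hK : involutive h by case=> x y; rewrite /h /= !tpermK.
rewrite (reindex_inj (inv_inj hK)) /=; apply: eq_big => [[x y]|[x y] _] /=.
  move: adj; rewrite /adjacent => /eqP adj.
  rewrite /h /= !xpair_eqE.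
  by case: tpermP => [->|->|/eqP + /eqP +]; case: tpermP => [->|->|/eqP + /eqP +];
    rewrite -!val_eqE /=; lia.
by rewrite /swap_pos !permM !tpermK.
Qed.

Lemma inv_swap_posP i j w : adjacent i j ->
  (inv (swap_pos i j w) < inv w)%N = (w j < w i)%N.
Proof.
move=> adj; case: (ltngtP (w j) (w i)) => [lt|gt|/val_inj/perm_inj e].
- have := @inv_swap_pos i j (swap_pos i j w) adj.
  by rewrite swap_posL swap_posR swap_posK => /(_ lt) ->; rewrite ltnSn.
- by rewrite inv_swap_pos // ltnNge leqW.
- by move: (adjacent_neq adj); rewrite e eqxx.
Qed.

Lemma inv_le w : (inv w <= n * n)%N.
Proof. by rewrite -{2 3}(card_ord n) -card_prod max_card. Qed.

Lemma w0_no_ascent i j : adjacent i j -> ~~ (w0 n i < w0 n j)%N.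
Proof. by rewrite /adjacent !permE /= => /eqP ->; lia. Qed.

Lemma no_ascent_w0 w :
  (forall i j, adjacent i j -> ~~ (w i < w j)%N) -> w = w0 n.
Proof.
move=> desc.
have lt i j : adjacent i j -> (w j < w i)%N.
  move=> adj; case: ltngtP (desc i j adj) => // /val_inj/perm_inj e.
  by move: (adjacent_neq adj); rewrite e eqxx.
have up (k : nat) i : k = i -> (w i + k < n)%N.
  elim: k i => [|k IH] i ki; first by rewrite addn0.
  have kn : (k < n)%N by have := ltn_ord i; lia.
  have := lt (Ordinal kn) i; rewrite /adjacent /= -ki eqxx => /(_ isT).
  by have := IH (Ordinal kn) erefl; lia.
have down (k : nat) i : (k + i).+1 = n -> (k <= w i)%N.
  elim: k i => [|k IH] i ki //.
  have kn : (i.+1 < n)%N by lia.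
  have := lt i (Ordinal kn); rewrite /adjacent /= eqxx => /(_ isT).
  by have := IH (Ordinal kn); rewrite /= => /(_ _); lia.
apply/permP => i; rewrite permE; apply/val_inj => /=.
have := up i i erefl; have := down (n - i.+1)%N i.
by have := ltn_ord i; lia.
Qed.

End Inversions.

Section Grothendieck.
Variable n : nat.
Implicit Types (w : 'S_n) (i j : 'I_n).

Definition is_grothendieck (G : {ffun 'S_n -> {mpoly int[n]}}) : bool :=
  (G (w0 n) == \prod_(i < n) 'X_i ^+ (n - i.+1)) &&
  [forall w, forall i, forall j,
     adjacent i j && (inv (swap_pos i j w) < inv w)%N ==>
     (idivdiff i j (G w) == G (swap_pos i j w))].

Lemma is_grothendieckP (G : {ffun 'S_n -> {mpoly int[n]}}) :
  reflect
    (G (w0 n) = \prod_(i < n) 'X_i ^+ (n - i.+1) /\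
     forall w i j, adjacent i j -> (inv (swap_pos i j w) < inv w)%N ->
       idivdiff i j (G w) = G (swap_pos i j w))
    (is_grothendieck G).
Proof.
apply: (iffP andP) => -[/eqP G0 GS]; split => //.
  move=> w i j adj lt; apply/eqP.
  by move/forallP: GS => /(_ w)/forallP/(_ i)/forallP/(_ j); rewrite adj lt.
apply/forallP => w; apply/forallP => i; apply/forallP => j.
by apply/implyP => /andP[adj lt]; apply/eqP/GS.
Qed.

(* groth_rec only serves to prove that a family satisfying is_grothendieck    *)
(* exists: it climbs from w to w0 along arbitrarily picked ascents.           *)
Fixpoint groth_rec (m : nat) w : {mpoly int[n]} :=
  if m isn't m'.+1 then \prod_(i < n) 'X_i ^+ (n - i.+1) else
  if [pick p | adjacent p.1 p.2 && (w p.1 < w p.2)%N] is Some p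
  then idivdiff p.1 p.2 (groth_rec m' (swap_pos p.1 p.2 w))
  else \prod_(i < n) 'X_i ^+ (n - i.+1).

Definition groth_step w := groth_rec (n * n - inv w) w.

Lemma groth_step_ascent w i j : adjacent i j -> (w i < w j)%N ->
  exists a b, [/\ adjacent a b, (w a < w b)%N
    & groth_step w = idivdiff a b (groth_step (swap_pos a b w))].
Proof.
move=> adj wij; rewrite {1}/groth_step.
have := inv_le (swap_pos i j w); rewrite inv_swap_pos // => le.
case E: (n * n - inv w)%N => [|m] /=; first by lia.
case: pickP => [[a b] /= /andP[ab wab]|/(_ (i, j))]; last by rewrite /= adj wij.
have Em : (n * n - inv (swap_pos a b w))%N = m by rewrite inv_swap_pos // subnS E.
by exists a, b; split; [exact: ab | exact: wab | rewrite /groth_step Em].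
Qed.

Lemma ascent_indep (G : 'S_n -> {mpoly int[n]}) :
  (forall w i j, adjacent i j -> (w i < w j)%N ->
     exists a b, [/\ adjacent a b, (w a < w b)%N
       & G w = idivdiff a b (G (swap_pos a b w))]) ->
  forall w i j, adjacent i j -> (w i < w j)%N ->
    G w = idivdiff i j (G (swap_pos i j w)).
Proof.
move=> G_some w i j.
have [m] := ubnP (n * n - inv w)%N; elim: m w i j => // m IH w i j mP adj wij.
have lower a b (u : 'S_n) : adjacent a b -> (u a < u b)%N ->
    (n * n - inv (swap_pos a b u) < n * n - inv u)%N.
  move=> ab uab; have := inv_le (swap_pos a b u).
  by rewrite inv_swap_pos //; lia.
have braid a b c : adjacent a b -> adjacent b c -> (w a < w b < w c)%N ->
    idivdiff a b (G (swap_pos a b w)) = idivdiff b c (G (swap_pos b c w)).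
  move=> ab bc /andP[wab wbc]; have wac := ltn_trans wab wbc.
  have abN := adjacent_neq ab; have bcN := adjacent_neq bc.
  have acN : a != c.
    by move: ab bc; rewrite /adjacent -val_eqE /= => /eqP ? /eqP ?; lia.
  have [baN cbN caN] : [/\ b != a, c != b & c != a].
    by rewrite !(eq_sym _ a) (eq_sym c).
  have V := (swap_posL, swap_posR, swap_posD).
  have l1 := lower _ _ _ ab wab; have l2 := lower _ _ _ bc wbc.
  have h1 : (swap_pos a b w b < swap_pos a b w c)%N by rewrite !V.
  have h2 : (swap_pos b c w a < swap_pos b c w b)%N by rewrite !V.
  have l3 := lower _ _ _ bc h1; have l4 := lower _ _ _ ab h2.
  have h3 : (swap_pos b c (swap_pos a b w) a <
             swap_pos b c (swap_pos a b w) b)%N by rewrite !V.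
  have h4 : (swap_pos a b (swap_pos b c w) b <
             swap_pos a b (swap_pos b c w) c)%N by rewrite !V.
  have E1 : G (swap_pos a b w) = _ := IH _ _ _ (leq_trans l1 mP) bc h1.
  have E2 : G (swap_pos b c w) = _ := IH _ _ _ (leq_trans l2 mP) ab h2.
  have E3 : G (swap_pos b c (swap_pos a b w)) = _ :=
    IH _ _ _ (leq_trans l3 (ltnW (leq_trans l1 mP))) ab h3.
  have E4 : G (swap_pos a b (swap_pos b c w)) = _ :=
    IH _ _ _ (leq_trans l4 (ltnW (leq_trans l2 mP))) bc h4.
  have Ew : swap_pos a b (swap_pos b c (swap_pos a b w)) =
            swap_pos b c (swap_pos a b (swap_pos b c w)).
    by rewrite /swap_pos !mulgA tpermJ3.
  have L := congr1 (idivdiff a b) (etrans E1 (congr1 (idivdiff b c) E3)).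
  have R := congr1 (idivdiff b c) (etrans E2 (congr1 (idivdiff a b) E4)).
  apply: (etrans L); apply: (etrans _ (esym R)).
  rewrite -(congr1 G Ew); exact: (idivdiff_braid _ abN acN bcN).
have [a [b [ab wab ->]]] := G_some _ _ _ adj wij.
have [e|ne] := eqVneq a i.
  have -> : b = j by apply/val_inj => /=; rewrite (eqP ab) (eqP adj) e.
  by rewrite e.
have [e|bi] := eqVneq b i.
  by subst b; apply: (braid _ _ _ ab adj); rewrite wab.
have [e|ja] := eqVneq j a.
  by subst a; apply: esym; apply: (braid _ _ _ adj ab); rewrite wij.
have bj : b != j.
  apply: contra_neq ne => e; apply/val_inj => /=; move: ab adj.
  by rewrite /adjacent e => /eqP -> /eqP[].
have abN := adjacent_neq ab; have ijN := adjacent_neq adj.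
have aj : a != j by rewrite eq_sym.
have ib : i != b by rewrite eq_sym.
have ia : i != a by rewrite eq_sym.
have jb : j != b by rewrite eq_sym.
have l1 := lower _ _ _ ab wab; have l2 := lower _ _ _ adj wij.
have h1 : (swap_pos a b w i < swap_pos a b w j)%N by rewrite !swap_posD.
have h2 : (swap_pos i j w a < swap_pos i j w b)%N by rewrite !swap_posD.
have E1 : G (swap_pos a b w) = _ := IH _ _ _ (leq_trans l1 mP) adj h1.
have E2 : G (swap_pos i j w) = _ := IH _ _ _ (leq_trans l2 mP) ab h2.
have U : uniq [:: a; b; i; j].
  by rewrite /= !inE !negb_or ne bi aj bj abN ijN.
have Ew : swap_pos i j (swap_pos a b w) = swap_pos a b (swap_pos i j w).
  by rewrite /swap_pos !mulgA; congr (_ * w)%g; rewrite conjgC tpermJ !tpermD.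
apply: (etrans (congr1 (idivdiff a b) E1)).
apply: (etrans _ (esym (congr1 (idivdiff i j) E2))).
rewrite -(congr1 G Ew); exact: (idivdiff_comm _ U).
Qed.

Lemma grothendieck_exists : exists G, is_grothendieck G.
Proof.
exists [ffun w => groth_step w]; apply/is_grothendieckP; split.
  rewrite ffunE /groth_step; case: (n * n - _)%N => //= m.
  case: pickP => // -[i j] /= /andP[adj].
  by rewrite (negbTE (w0_no_ascent adj)).
move=> w i j adj; rewrite inv_swap_posP // !ffunE => wij.
have lt : (swap_pos i j w i < swap_pos i j w j)%N.
  by rewrite swap_posL swap_posR.
by have := ascent_indep groth_step_ascent adj lt; rewrite swap_posK => e; apply: esym e.
Qed.

Lemma is_grothendieck_unique (G H : {ffun 'S_n -> {mpoly int[n]}}) :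
  is_grothendieck G -> is_grothendieck H -> G = H.
Proof.
move=> /is_grothendieckP[G0 GS] /is_grothendieckP[H0 HS]; apply/ffunP => w.
have [m] := ubnP (n * n - inv w)%N; elim: m w => // m IH w mP.
have [/existsP[[i j]] /= /andP[adj wij]|none] :=
  boolP [exists p, adjacent p.1 p.2 && (w p.1 < w p.2)%N]; last first.
  rewrite [w]no_ascent_w0 ?G0 ?H0 // => i j adj.
  by move: none; rewrite negb_exists => /forallP/(_ (i, j)) /=; rewrite adj.
have lt : (inv (swap_pos i j (swap_pos i j w)) < inv (swap_pos i j w))%N.
  by rewrite inv_swap_posP // swap_posL swap_posR.
have := GS _ _ _ adj lt; have := HS _ _ _ adj lt; rewrite swap_posK => <- <-.
congr (idivdiff _ _ _); apply: IH.
by have := inv_le (swap_pos i j w); rewrite inv_swap_pos //; lia.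
Qed.

Definition grothendieck : {ffun 'S_n -> {mpoly int[n]}} :=
  xchoose grothendieck_exists.

Lemma grothendieckP : is_grothendieck grothendieck.
Proof. exact: xchooseP. Qed.

End Grothendieck.

Section CastelnuovoMumford.
Variable n : nat.

(* msize f is one more than the degree of f (and 0 for f = 0).               *)
Definition mpoly_deg (R : nzRingType) (f : {mpoly R[n]}) : nat := (msize f).-1.

Definition top_part (R : nzRingType) (f : {mpoly R[n]}) : {mpoly R[n]} :=
  pihomog mdeg (mpoly_deg f) f.

Definition cm_poly (w : 'S_n) : {mpoly int[n]} :=
  top_part
    ((-1) ^ ((mpoly_deg (grothendieck n w))%:Z - (inv w)%:Z)
       *: grothendieck n w).

End CastelnuovoMumford.

(* Main.v *)
Require Import Defs.
From mathcomp Require Import all_boot all_order all_algebra all_fingroup.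
From mathcomp Require Import mpoly.
From mathcomp Require Import ring zify.

Set Implicit Arguments.
Unset Strict Implicit.
Unset Printing Implicit Defensive.

Import GRing.Theory.
Import Order.TTheory Num.Theory.
Local Open Scope ring_scope.

(** Let r = rajcode(u), and call an exponent vector s dominating when each of
    its prefix sums is at least that of r.  The theorem rests on two facts:

    - the Grothendieck polynomial of u has degree |r|, contains the monomial
      x^r, and all its monomials of degree |r| dominate r
      (grothendieck_leading).  So proportional polynomials have rajcodes that
      dominate each other, and dominates_anti makes these equal;
    - the part of degree |r| depends on r only, up to a scalar
      (same_raj_proportional).

    Write L_k = n - k - r_k for the greatest length of an increasing
    subsequence starting at position k.  Then u has an ascent at i exactly when
    L_i > L_(i+1).  Both facts are proved by induction from w0 downwards, and the
    inductive step is governed by the ascents with L_i > L_(i+1) + 1, which r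
    determines.  At such an ascent no longest increasing subsequence from i
    passes through i + 1, so that passing from u to w = u s_i merely exchanges
    L_i and L_(i+1) (lis_swap_pos).  Hence rajcode(w) has the same sum as r, and
    the divided difference that turns the polynomial of w into that of u does so
    without lowering the degree; it acts on top-degree parts, which settles the
    second fact.  For the first, let i be the last ascent of this kind: then the
    exponents of x_i in the polynomial of w are at most rajcode(w)_i, and this
    is what makes dominance pass from w to u (idivdiff_dominates,
    idivdiff_lead).

    If L_i <= L_(i+1) + 1 for all i, the part of degree |r| is a multiple of x^r,
    by two estimates that hold for every permutation:

    - the exponent of x_k is at most n - k minus the number of left-to-right
      maxima of u(k) u(k+1) ... (grothendieck_deg_records).  In the present case
      there are at least L_k such maxima (card_records_ge_lis), so the exponent
      is at most r_k;
    - some monomial x^s occurs with s_k >= r_k for all k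
      (grothendieck_coeff_ge_raj).

    The second estimate uses the pipe dream formula of Fomin and Kirillov, which
    writes the generating function of all Grothendieck polynomials as a product
    of factors 1 + x_m pi_j over a 0-Hecke algebra (grothendieck_pipe_sum).  Its
    terms do not cancel, so that it suffices to exhibit one pipe dream for u with
    at least r_k crossings in each row k (reach_row, reach_rows). *)

(** * Hecke operators on functions of a permutation *)

Section DemazureOperators.
Variables (n : nat) (K : idomainType).
Local Notation T := {ffun 'S_n -> K}.
Implicit Types (f g h : T) (x y : K) (p : 'S_n) (a b c d i j : 'I_n).

(** In the 0-Hecke algebra with generators pi_j, where pi_j ^ 2 = - pi_j, a
    function f stands for the sum of the f(p) T_(p^-1), and this operator is left
    multiplication by 1 + x pi, where pi switches the values a and b of p^-1.
    Indexing by inverses turns this into a switch of positions of p. *)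
Definition hecke_op a b x f : T := [ffun p : 'S_n =>
  if (p b < p a)%N then (1 - x) * f p + x * f (swap_pos a b p) else f p].

Lemma hecke_opE a b x f (p : 'S_n) : hecke_op a b x f p =
  if (p b < p a)%N then (1 - x) * f p + x * f (swap_pos a b p) else f p.
Proof. exact: ffunE. Qed.

Lemma swap_pos_comm a b c d p : uniq [:: a; b; c; d] ->
  swap_pos a b (swap_pos c d p) = swap_pos c d (swap_pos a b p).
Proof.
rewrite /= !inE !negb_or => /and4P[/and3P[ab ac ad] /andP[bc bd] cd _].
rewrite /swap_pos !mulgA; congr (_ * p)%g.
by rewrite conjgC tpermJ !tpermD // eq_sym.
Qed.

Lemma hecke_op_comm a b c d x y f : uniq [:: a; b; c; d] ->
  hecke_op a b x (hecke_op c d y f) = hecke_op c d y (hecke_op a b x f).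
Proof.
move=> U; have := U; rewrite /= !inE !negb_or.
move=> /and4P[/and3P[ab ac ad] /andP[bc bd] cd _].
have [ca da cb db] : [/\ c != a, d != a, c != b & d != b].
  by rewrite !(eq_sym _ a) !(eq_sym _ b).
apply/ffunP => p; rewrite !hecke_opE !swap_posD //.
by case: ifP => _ //; case: ifP => _ //; rewrite (swap_pos_comm p U); ring.
Qed.

Lemma hecke_op_self a b x y f :
  hecke_op a b x (hecke_op a b y f) = hecke_op a b (x + y - x * y) f.
Proof.
apply/ffunP => p; rewrite !hecke_opE swap_posL swap_posR swap_posK.
by case: (ltngtP (p b) (p a)) => // _; ring.
Qed.

Lemma swap_pos_braid a b c p : a != b -> a != c -> b != c ->
  swap_pos a b (swap_pos b c (swap_pos a b p)) =
  swap_pos b c (swap_pos a b (swap_pos b c p)).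
Proof. by move=> ab ac bc; rewrite /swap_pos !mulgA tpermJ3. Qed.

(** The Yang-Baxter relation without denominators: 1 - y (1 + pi) is 1 - y times
    the inverse of 1 + y pi, and hecke_op b c 1 is 1 + pi. *)
Lemma hecke_op_hexagon a b c x y f p : a != b -> a != c -> b != c ->
  let A := hecke_op a b x (hecke_op b c y (hecke_op a b y f)) in
  let B := hecke_op a b y (hecke_op b c x (hecke_op a b x f)) in
  (1 - x) * (A p - y * hecke_op b c 1 A p) = (1 - y) * (B p - x * hecke_op b c 1 B p).
Proof.
move=> ab ac bc /=; have [ba ca cb] : [/\ b != a, c != a & c != b].
  by rewrite !(eq_sym _ a) (eq_sym c).
rewrite !hecke_opE.
do 4?rewrite !(swap_posL, swap_posR, swap_posK, swap_posD) //.
rewrite ?swap_pos_braid //.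
case: (ltngtP (p a) (p b)) => [ab'|ab'|/val_inj/perm_inj/eqP];
  last by rewrite (negbTE ab).
all: case: (ltngtP (p b) (p c)) => [bc'|bc'|/val_inj/perm_inj/eqP];
  try by rewrite (negbTE bc).
all: case: (ltngtP (p a) (p c)) => [ac'|ac'|/val_inj/perm_inj/eqP];
  try by rewrite (negbTE ac).
all: try (exfalso; lia).
all: ring.
Qed.

(** Linearity over K, phrased for the relations between four functions that occur
    below; taking some coefficients to be 0 gives the usual form. *)
Definition pointwise_linear (O : T -> T) := forall (r s r' s' : K) (f g h k : T),
  (forall p, r * f p + s * g p = r' * h p + s' * k p) ->
  forall p, r * O f p + s * O g p = r' * O h p + s' * O k p.

Lemma pointwise_linear_hecke_op a b x : pointwise_linear (hecke_op a b x).
Proof.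
move=> r s r' s' f g h k e p; rewrite !hecke_opE; case: ifP => // _.
rewrite !mulrDr addrACA [RHS]addrACA !(mulrCA _ (1 - x)) !(mulrCA _ x).
by rewrite -!mulrDr !e.
Qed.

Lemma pointwise_linear_comp O O' :
  pointwise_linear O -> pointwise_linear O' -> pointwise_linear (O \o O').
Proof. by move=> l l' r s r' s' f g h k /l'/l. Qed.

Lemma tperm_adjacent_lt a b i j : adjacent a b ->
  ~~ ((i == a) && (j == b)) -> ~~ ((i == b) && (j == a)) ->
  (tperm a b i < tperm a b j)%N = (i < j)%N.
Proof.
rewrite /adjacent -!val_eqE /= => /eqP adj.
case: tpermP => [->|->|/eqP + /eqP +]; case: tpermP => [->|->|/eqP + /eqP +];
  rewrite -?val_eqE /= ?eqxx /= => *; lia.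
Qed.

(** Right multiplication by 1 + pi, where pi switches the entries of p^-1 at the
    positions a and b: the coefficient of T_u in the product is that of the
    shorter of the two permutations u and u with these entries switched. *)
Definition right_idem a b f : T := [ffun p : 'S_n =>
  if ((p^-1)%g b < (p^-1)%g a)%N then f (p * tperm a b)%g else f p].

Lemma right_idemE a b f (p : 'S_n) : right_idem a b f p =
  if ((p^-1)%g b < (p^-1)%g a)%N then f (p * tperm a b)%g else f p.
Proof. exact: ffunE. Qed.

(** Left and right multiplications commute.  The two switches interact only when
    they move the same two entries; then both sides take the value of f at the
    shorter permutation. *)
Lemma right_idem_hecke_op a b c d x f : adjacent a b -> adjacent c d ->
  right_idem a b (hecke_op c d x f) = hecke_op c d x (right_idem a b f).
Proof.
move=> ab cd; apply/ffunP => p.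
have abN := adjacent_neq ab; have cdN := adjacent_neq cd.
have lab : (a < b)%N by rewrite (eqP ab).
have lcd : (c < d)%N by rewrite (eqP cd).
have [nab ncd] : (b < a)%N = false /\ (d < c)%N = false.
  by split; lia.
rewrite !(hecke_opE, right_idemE) /swap_pos !invMg !tpermV !permM !mulgA.
have [/andP[/eqP pc /eqP pd]|N1] := boolP ((p c == a) && (p d == b)).
  have [qa qb] : (p^-1)%g a = c /\ (p^-1)%g b = d by rewrite -pc -pd !permK.
  by rewrite qa qb pc pd nab ncd.
have [/andP[/eqP pc /eqP pd]|N2] := boolP ((p c == b) && (p d == a)).
  have [qa qb] : (p^-1)%g b = c /\ (p^-1)%g a = d by rewrite -pc -pd !permK.
  have e : (tperm c d * p)%g = (p * tperm a b)%g.
    by rewrite conjgC tpermJ pc pd tpermC.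
  rewrite qa qb pc pd lcd lab !tpermL !tpermR nab.
  by rewrite ncd e; ring.
rewrite (tperm_adjacent_lt ab (i := p d)) // 1?andbC //.
rewrite (tperm_adjacent_lt cd).
- by case: ifP => //; case: ifP.
- by apply: contra N2 => /andP[/eqP <- /eqP <-]; rewrite !permKV !eqxx.
- by apply: contra N1 => /andP[/eqP <- /eqP <-]; rewrite !permKV !eqxx.
Qed.

Definition delta_id : T := [ffun p : 'S_n => (p == 1%g)%:R].

Lemma right_idem_delta_id a b : adjacent a b ->
  right_idem a b delta_id = hecke_op a b 1 delta_id.
Proof.
move=> ab; have lab : (a < b)%N by rewrite (eqP ab).
apply/ffunP => p; rewrite right_idemE hecke_opE /swap_pos subrr mul0r add0r mul1r !ffunE.
have eL : (p * tperm a b == 1)%g = (p == tperm a b).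
  by rewrite -(inj_eq (mulIg (tperm a b))) -mulgA tperm2 mulg1 mul1g.
have eR : (tperm a b * p == 1)%g = (p == tperm a b).
  by rewrite -(inj_eq (mulgI (tperm a b))) mulgA tperm2 mulg1 mul1g.
rewrite eL eR; have [->|_] := eqVneq p (tperm a b).
  by rewrite tpermV tpermL tpermR lab.
have [->|_] := eqVneq p 1%g; last by rewrite !if_same.
by rewrite invg1 !perm1 ltnNge (ltnW lab).
Qed.

End DemazureOperators.

(** * The Fomin-Kirillov product and its symmetry *)

Section Rows.
Variables (N : nat) (K : idomainType).
Local Notation T := {ffun 'S_N.+1 -> K}.
Local Notation o j := (inord j : 'I_N.+1).
Implicit Types (f g h : T) (x y : K) (p : 'S_N.+1) (xi : nat -> K).

Definition hecke_at j x f := hecke_op (o j) (o j.+1) x f.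

Lemma adjacent_inord j : (j < N)%N -> adjacent (o j) (o j.+1).
Proof. by move=> jN; rewrite /adjacent !inordK //; lia. Qed.

Lemma inord_neq j k : (j <= N)%N -> (k <= N)%N -> j != k -> o j != o k.
Proof. by move=> jN kN; rewrite -val_eqE /= !inordK. Qed.

Lemma hecke_at_comm j k x y f : (j < N)%N -> (k < N)%N -> (j.+1 < k)%N ->
  hecke_at j x (hecke_at k y f) = hecke_at k y (hecke_at j x f).
Proof.
move=> jN kN jk; apply: hecke_op_comm.
by rewrite /= !inE !negb_or !inord_neq //; lia.
Qed.

(** Left multiplication by (1 + x pi_(N-1)) ... (1 + x pi_m), one row of the
    Fomin-Kirillov product; the factor of index m acts first. *)
Definition row_op m x f : T := foldl (fun g j => hecke_at j x g) f (iota m (N - m)).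

Lemma row_op_rec m x f : (m < N)%N -> row_op m x f = row_op m.+1 x (hecke_at m x f).
Proof. by move=> mN; rewrite /row_op -(subnSK mN). Qed.

Lemma row_op_ge m x f : (N <= m)%N -> row_op m x f = f.
Proof. by rewrite /row_op -subn_eq0 => /eqP ->. Qed.

Lemma down_ind (P : nat -> Prop) :
  (forall m, (N <= m)%N -> P m) -> (forall m, (m < N)%N -> P m.+1 -> P m) ->
  forall m, P m.
Proof.
move=> P0 PS m; move Ed: (N - m)%N => d; elim: d m Ed => [|d IH] m Ed.
  by apply: P0; lia.
by apply: PS; [lia | apply: IH; lia].
Qed.

Lemma pointwise_linear_row_op m x : pointwise_linear (row_op m x).
Proof.
elim/down_ind: m => m mN => [|IH] r s r' s' f g h k e p.
  by rewrite !row_op_ge.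
by rewrite !(row_op_rec _ _ mN); apply/IH/pointwise_linear_hecke_op.
Qed.

Lemma hecke_at_row_op j m x y f : (j < N)%N -> (j.+1 < m)%N ->
  hecke_at j y (row_op m x f) = row_op m x (hecke_at j y f).
Proof.
move=> jN; elim/down_ind: m f => m mN => [|IH] f jm.
  by rewrite !row_op_ge.
by rewrite !(row_op_rec _ _ mN) IH 1?hecke_at_comm //; lia.
Qed.

Lemma right_idem_row_op a b m x f : adjacent a b ->
  right_idem a b (row_op m x f) = row_op m x (right_idem a b f).
Proof.
move=> ab; elim/down_ind: m f => m mN => [|IH] f.
  by rewrite !row_op_ge.
by rewrite !(row_op_rec _ _ mN) IH /hecke_at right_idem_hecke_op // adjacent_inord.
Qed.

(** Because (1 + y pi) (1 - y (1 + pi)) = 1 - y, the row of y can be extended by its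
    missing factor 1 + y pi_m at the price of the operator 1 - y (1 + pi_m). *)
Lemma row_op_pair m x y f p : (m < N)%N ->
  (1 - y) * row_op m x (row_op m.+1 y f) p =
  row_op m x (row_op m y f) p - y * row_op m x (row_op m y (hecke_at m 1 f)) p.
Proof.
move=> mN; rewrite !(row_op_rec y _ mN).
have l : pointwise_linear (row_op m x \o row_op m.+1 y).
  by apply: pointwise_linear_comp; apply: pointwise_linear_row_op.
rewrite -mulNr -[LHS]addr0.
rewrite -[X in _ + X](mul0r (row_op m x (row_op m.+1 y f) p)).
rewrite -[X in _ = X + _]mul1r.
apply: (l (1 - y) 0 1 (- y) f f) => q.
rewrite /hecke_at hecke_op_self !hecke_opE.
by case: ifP => _; ring.
Qed.

(** After multiplication by (1 - x) (1 - y), row_op_pair writes both sides as the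
    product of the two rows starting at m + 1, which is symmetric by induction,
    applied to the two sides of hecke_op_hexagon. *)
Lemma row_op_comm m x y f : 1 - x != 0 -> 1 - y != 0 ->
  row_op m x (row_op m y f) = row_op m y (row_op m x f).
Proof.
move=> x1 y1; elim/down_ind: m f => m mN => [|IH] f.
  by rewrite !row_op_ge.
have [mN'|mN'] := leqP N m.+1.
  rewrite !(row_op_rec _ _ mN) !(row_op_ge _ _ mN') /hecke_at !hecke_op_self.
  by congr (hecke_op _ _ _ _); ring.
have K1 z t g : row_op m z (row_op m t g) =
    row_op m.+1 z (row_op m.+2 t (hecke_at m z (hecke_at m.+1 t (hecke_at m t g)))).
  by rewrite !(row_op_rec _ _ mN) (row_op_rec t _ mN') hecke_at_row_op.
rewrite !K1; set A := hecke_at m x _; set B := hecke_at m y _.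
have e : forall p, (1 - x) * A p + (- ((1 - x) * y)) * hecke_at m.+1 1 A p =
    (1 - y) * B p + (- ((1 - y) * x)) * hecke_at m.+1 1 B p.
  have := @hecke_op_hexagon _ _ (o m) (o m.+1) (o m.+2) x y f.
  move=> hex p; have := hex p.
  rewrite !inord_neq; try lia.
  move=> /(_ isT isT isT) /= {}hex.
  by rewrite !mulNr -!mulrA -!mulrBr.
apply/ffunP => p; apply: (mulfI x1); apply: (mulfI y1).
rewrite [LHS]mulrCA (row_op_pair x y) // [in RHS](row_op_pair y x) //.
have l : pointwise_linear (row_op m.+1 x \o row_op m.+1 y).
  by apply: pointwise_linear_comp; apply: pointwise_linear_row_op.
have := l _ _ _ _ _ _ _ _ e p; rewrite /= !mulrBr !mulNr !mulrA.
by rewrite !(IH A) !(IH B) !(IH (hecke_at _ _ _)).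
Qed.

(** By row_op_pair both products on the right are the same symmetric product of
    two rows, applied to 1 - y (1 + pi_m) and to 1 - x (1 + pi_m); the difference
    of these two operators is (x - y) (1 + pi_m). *)
Lemma row_op_pair_diff m x y f p : (m < N)%N -> 1 - x != 0 -> 1 - y != 0 ->
  (x - y) * row_op m x (row_op m.+1 y (hecke_at m 1 f)) p =
  (1 - y) * row_op m x (row_op m.+1 y f) p -
  (1 - x) * row_op m y (row_op m.+1 x f) p.
Proof.
move=> mN x1 y1; rewrite !row_op_pair // !(row_op_comm _ _ y1 x1).
have -> : row_op m x (row_op m.+1 y (hecke_at m 1 f)) =
          row_op m x (row_op m y (hecke_at m 1 f)).
  rewrite [in RHS](row_op_rec y) // /hecke_at hecke_op_self.
  by congr (row_op _ _ (row_op _ _ (hecke_op _ _ _ _))); ring.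
by ring.
Qed.

Definition rows xi m : T :=
  foldr (fun k f => row_op k (xi k) f) (delta_id N.+1 K) (iota m (N.+1 - m)).

Lemma rows_rec xi m : rows xi m = row_op m (xi m) (rows xi m.+1).
Proof.
have [mN|mN] := leqP m N; first by rewrite /rows -(subnSK (mN : m < N.+1)%N).
rewrite row_op_ge; last exact: ltnW.
by rewrite /rows; have [-> ->] : (N.+1 - m = 0 /\ N.+1 - m.+1 = 0)%N by lia.
Qed.

Lemma rows_gt xi m : (N < m)%N -> rows xi m = delta_id N.+1 K.
Proof. by rewrite /rows -subn_eq0 => /eqP ->. Qed.

Lemma rows_ext xi xi' m : (forall k, (m <= k)%N -> xi k = xi' k) ->
  rows xi m = rows xi' m.
Proof.
move=> e; rewrite /rows.
have : forall k, k \in iota m (N.+1 - m) -> xi k = xi' k.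
  by move=> k; rewrite mem_iota => /andP[/e].
elim: iota => //= k s IH {}e; rewrite e ?mem_head // IH // => l ls.
by rewrite e // inE ls orbT.
Qed.

(** The rows from m on involve only generators of index greater than i + 1.  These
    commute with pi_i, so that pi_i can be moved from the right end of the product
    to its left end. *)
Lemma right_idem_rows xi i m : (i < N)%N -> (i.+1 < m)%N ->
  right_idem (o i) (o i.+1) (rows xi m) = hecke_at i 1 (rows xi m).
Proof.
move=> iN im.
have [d] := ubnP (N.+1 - m)%N; elim: d m im => // d IH m im md.
have [mN|mN] := ltnP N m.
  by rewrite rows_gt // right_idem_delta_id // adjacent_inord.
rewrite rows_rec right_idem_row_op ?adjacent_inord // IH; try lia.
by rewrite hecke_at_row_op.
Qed.

(** The recursion that defines Grothendieck polynomials, for the whole product at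
    once: exchanging two consecutive variables affects two consecutive rows, to
    which row_op_pair_diff applies, and left multiplication by the rows before them
    commutes with the right multiplication. *)
Lemma rows_exchange xi xi' i m p : (i < N)%N -> (m <= i)%N ->
  xi' i = xi i.+1 -> xi' i.+1 = xi i ->
  (forall k, k != i -> k != i.+1 -> xi' k = xi k) ->
  1 - xi i != 0 -> 1 - xi i.+1 != 0 ->
  (xi i - xi i.+1) * right_idem (o i) (o i.+1) (rows xi m) p =
  (1 - xi i.+1) * rows xi m p - (1 - xi i) * rows xi' m p.
Proof.
move=> iN mi e1 e2 e3 x1 y1; have ad := adjacent_inord iN.
have eR : rows xi' i.+2 = rows xi i.+2 by apply: rows_ext => k ik; apply: e3; lia.
move Ed: (i - m)%N => d; elim: d m mi Ed p => [|d IH] m mi Ed p.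
  have -> : m = i by lia.
  rewrite (rows_rec xi i) (rows_rec xi i.+1) (rows_rec xi' i) (rows_rec xi' i.+1).
  rewrite e1 e2 eR -row_op_pair_diff // !right_idem_row_op // right_idem_rows //.
rewrite (rows_rec xi m) (rows_rec xi' m) e3; try lia.
rewrite right_idem_row_op //; have l := @pointwise_linear_row_op m (xi m).
have e q : (xi i - xi i.+1) * right_idem (o i) (o i.+1) (rows xi m.+1) q +
      0 * rows xi m.+1 q =
    (1 - xi i.+1) * rows xi m.+1 q + (- (1 - xi i)) * rows xi' m.+1 q.
  by rewrite mul0r addr0 mulNr IH //; lia.
by have := l _ _ _ _ _ _ _ _ e p; rewrite mul0r addr0 mulNr.
Qed.

End Rows.

(** * Longest increasing subsequences *)

Section IncreasingSubsequences.
Variable n : nat.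
Implicit Types (w u : 'S_n) (i j k p q : 'I_n) (S : {set 'I_n}).

Definition lis w k : nat := \max_(S : {set 'I_n} | incr_from w k S) #|S|.

Lemma incr_fromP w k S :
  reflect [/\ k \in S, forall i, i \in S -> (k <= i)%N
    & forall i j, i \in S -> j \in S -> (i < j)%N -> (w i < w j)%N]
  (incr_from w k S).
Proof.
apply: (iffP and3P) => -[kS].
  move=> /forall_inP H /forall_inP H'; split=> // i j iS jS.
  by apply/implyP; move/forall_inP: (H' i iS); apply.
move=> H H'; split=> //; first by apply/forall_inP.
by apply/forall_inP => i iS; apply/forall_inP => j jS; apply/implyP/H'.
Qed.

Lemma lis_attained w k : {S | incr_from w k S & lis w k = #|S|}.
Proof.
have H : incr_from w k [set k].
  apply/incr_fromP; split=> [|i|i j]; rewrite !inE ?eqxx // => /eqP -> //.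
  by move=> /eqP ->; rewrite ltnn.
have A0 : (0 < #|[pred S | incr_from w k S]|)%N.
  by apply/card_gt0P; exists [set k].
by have [S SP e] := eq_bigmax_cond (fun S => #|S|) A0; exists S.
Qed.

Lemma lis_ge w k S : incr_from w k S -> (#|S| <= lis w k)%N.
Proof. by move=> H; exact: (@leq_bigmax_cond _ (incr_from w k) (fun S => #|S|) S H). Qed.

Lemma lis_gt0 w k : (0 < lis w k)%N.
Proof.
have [S /incr_fromP[kS _ _] ->] := lis_attained w k.
by apply/card_gt0P; exists k.
Qed.

Lemma lis_step w p q : (p < q)%N -> (w p < w q)%N -> (lis w q < lis w p)%N.
Proof.
move=> pq wpq; have [S /incr_fromP[qS Sge Sinc] ->] := lis_attained w q.
have pS : p \notin S by apply: contraL pq => /Sge; rewrite -leqNgt.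
suff /lis_ge : incr_from w p (p |: S) by rewrite cardsU1 pS.
have wpS i : i \in S -> (w p < w i)%N.
  move=> iS; apply: (leq_trans wpq); have := Sge _ iS.
  by rewrite leq_eqVlt => /orP[/eqP/val_inj -> //|/(Sinc _ _ qS iS)/ltnW].
apply/incr_fromP; split=> [|i|i j]; rewrite !inE ?eqxx //.
  by case/orP => [/eqP -> //|/Sge]; lia.
case/orP => [/eqP ->|iS] /orP[/eqP ->|jS]; rewrite ?ltnn //.
- by move=> _; apply: wpS.
- by have := Sge _ iS; lia.
- exact: Sinc.
Qed.

Lemma lis_next w p : (1 < lis w p)%N ->
  exists q, [/\ (p < q)%N, (w p < w q)%N & (lis w q).+1 = lis w p].
Proof.
have [S /incr_fromP[pS Sge Sinc] eS] := lis_attained w p; rewrite eS => S1.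
have : (0 < #|S :\ p|)%N by move: S1; rewrite (cardsD1 p S) pS.
case/card_gt0P => q0 q0S.
have [q qS qmin] :=
  arg_minnP (P := fun i => i \in S :\ p) (fun i : 'I_n => i : nat) q0S.
move: qS; rewrite !inE => /andP[qp qS].
have pq : (p < q)%N.
  by have := Sge _ qS; rewrite leq_eqVlt eq_sym val_eqE (negbTE qp).
have wpq := Sinc _ _ pS qS pq; exists q; split => //; apply/eqP.
rewrite eqn_leq -{1}eS lis_step //= (cardsD1 p S) pS ltnS.
apply: lis_ge; apply/incr_fromP; split => [|i /qmin //|i j].
  by rewrite !inE qp.
by rewrite !inE => /andP[_ iS] /andP[_ jS]; apply: Sinc.
Qed.

(** The recursion expressed by lis_step and lis_next determines lis on each final
    segment of positions. *)
Lemma lis_unique w (m : nat) (l : 'I_n -> nat) :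
  (forall p, (m <= p)%N -> (0 < l p)%N) ->
  (forall p q, (m <= p)%N -> (p < q)%N -> (w p < w q)%N -> (l q < l p)%N) ->
  (forall p, (m <= p)%N -> (1 < l p)%N ->
     exists q, [/\ (p < q)%N, (w p < w q)%N & (l q).+1 = l p]) ->
  forall p, (m <= p)%N -> lis w p = l p.
Proof.
move=> l0 lS lN p; have [d] := ubnP (n - p)%N; elim: d p => // d IH p pd mp.
have lt q : (p < q)%N -> lis w q = l q.
  by move=> pq; have := ltn_ord q; move=> qn; apply: IH; lia.
apply/eqP; rewrite eqn_leq; apply/andP; split.
  have [l1|/lis_next[q [pq wpq <-]]] := leqP (lis w p) 1.
    exact: leq_trans l1 (l0 _ mp).
  by rewrite lt //; apply: lS.
have [l1|/(lN _ mp)[q [pq wpq <-]]] := leqP (l p) 1.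
  exact: leq_trans l1 (lis_gt0 _ _).
by rewrite -lt //; apply: lis_step.
Qed.

Lemma lis_le w p : (lis w p <= n - p)%N.
Proof.
have [d] := ubnP (n - p)%N; elim: d p => // d IH p pd.
have [l1|/lis_next[q [pq _ <-]]] := leqP (lis w p) 1.
  by have := ltn_ord p; lia.
by have := ltn_ord q; have := IH q; lia.
Qed.

Lemma rajE w p : raj w p = (n - p - lis w p)%N.
Proof. by []. Qed.

Lemma raj_lis w p : (raj w p + lis w p = n - p)%N.
Proof. by rewrite rajE subnK // lis_le. Qed.

(** An inversion may become a noninversion p < q, without effect on lis, if the
    values of lis already decrease from p to q. *)
Lemma lis_eq_from u w m :
  (forall p q, (m <= p)%N -> (p < q)%N -> (u p < u q)%N -> (w p < w q)%N) ->
  (forall p q, (m <= p)%N -> (p < q)%N -> (w p < w q)%N -> (lis u q < lis u p)%N) ->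
  forall p, (m <= p)%N -> lis w p = lis u p.
Proof.
move=> uw wu p mp; apply: (lis_unique (m := m)) => // [q _|q mq]; first exact: lis_gt0.
by case/lis_next => r [qr uqr e]; exists r; split => //; apply: uw.
Qed.

(** The first term of an increasing subsequence from i can be replaced by the
    smaller entry at j. *)
Lemma lis_descent w i j : adjacent i j -> (w j < w i)%N ->
  (lis w i <= lis w j)%N.
Proof.
move=> adj wji; have [l1|/lis_next[q [iq wiq <-]]] := leqP (lis w i) 1.
  exact: leq_trans l1 (lis_gt0 _ _).
apply: lis_step; last exact: ltn_trans wji wiq.
rewrite (eqP adj) ltn_neqAle iq andbT -(eqP adj) val_eqE.
by apply: contraTneq wiq => <-; rewrite -leqNgt ltnW.
Qed.

Lemma adjacent_ascent_or w i j : adjacent i j ->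
  (w i < w j)%N \/ (w j < w i)%N.
Proof.
move=> adj; case: (ltngtP (w i) (w j)); [by left|by right|].
by move=> /val_inj/perm_inj e; move: (adjacent_neq adj); rewrite e eqxx.
Qed.

(** With lis_step, this shows that the positions of ascents can be read from lis. *)
Lemma lis_ascent w i j : adjacent i j -> (lis w j < lis w i)%N -> (w i < w j)%N.
Proof.
move=> adj; rewrite ltnNge; have [//|/(lis_descent adj) ->] := adjacent_ascent_or w adj.
by [].
Qed.

(** No longest increasing subsequence from i passes through j, so that switching
    the two entries carries their values of lis along and changes no other one. *)
Lemma lis_swap_pos w i j : adjacent i j -> ((lis w j).+1 < lis w i)%N ->
  forall p, lis (swap_pos i j w) p = lis w (tperm i j p).
Proof.
move=> adj skips p; have wij := lis_ascent adj (ltnW skips).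
have E q : swap_pos i j w q = w (tperm i j q) by rewrite /swap_pos permM.
have ij : (j = i.+1 :> nat) by apply/eqP.
apply: (lis_unique (m := 0%N) (l := fun p => lis w (tperm i j p))) => //
  [q _|q r _ qr|q _]; first exact: lis_gt0.
  rewrite !E => wqr; apply: lis_step => //.
  rewrite ltnNge; apply/negP => le; move: qr wqr le.
  case: tpermP => [->|->|/eqP + /eqP +]; case: tpermP => [->|->|/eqP + /eqP +];
    rewrite -?val_eqE /= => *; lia.
case/lis_next => r [qr wqr e]; exists (tperm i j r); rewrite !E tpermK; split => //.
rewrite ltnNge; apply/negP => le; move: qr wqr e le.
have [->|rj] := eqVneq r j.
  rewrite tpermR; case: tpermP => [->|->|/eqP + /eqP +];
    rewrite -?val_eqE /= => *; lia.
have [->|ri] := eqVneq r i.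
  rewrite tpermL; case: tpermP => [->|->|/eqP + /eqP +];
    rewrite -?val_eqE /= => *; lia.
have [ir jr] : i != r /\ j != r by rewrite ![_ == r]eq_sym.
rewrite (tpermD ir jr); move: rj ri.
case: tpermP => [->|->|/eqP + /eqP +]; rewrite -?val_eqE /= => *; lia.
Qed.

End IncreasingSubsequences.

(** * Left-to-right maxima *)

Section LeftToRightMaxima.
Variable n : nat.
Implicit Types (w u : 'S_n) (i j k p q : 'I_n).

(** The positions of the left-to-right maxima of u(k) u(k+1) .... *)
Definition records u k : {set 'I_n} :=
  [set q : 'I_n | (k <= q)%N && [forall p : 'I_n, (k <= p < q)%N ==> (u p < u q)%N]].

Lemma recordsP u k q :
  reflect ((k <= q)%N /\ forall p, (k <= p)%N -> (p < q)%N -> (u p < u q)%N)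
    (q \in records u k).
Proof.
rewrite inE; apply: (iffP andP) => -[kq]; split=> //.
  by move=> p kp pq; move/forallP: b => /(_ p); rewrite kp pq.
by apply/forallP => p; apply/implyP => /andP[kp pq]; apply: b.
Qed.

Lemma records_start u k : k \in records u k.
Proof. by apply/recordsP; split=> // p; rewrite ltnNge => ->. Qed.

Lemma adjacent_lt i j : adjacent i j -> (i < j)%N.
Proof. by move=> /eqP ->. Qed.

Lemma adjacent_gt i j q : adjacent i j -> (i < q)%N -> q != j -> (j < q)%N.
Proof. by rewrite -val_eqE /= => /eqP ->; lia. Qed.

Lemma card_records_ascent u i j : adjacent i j -> (u i < u j)%N ->
  #|records u i| = (#|records u j|).+1.
Proof.
move=> adj uij; have lt := adjacent_lt adj.
have -> : records u i = i |: records u j.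
  apply/setP => q; rewrite in_setU1; have [->|qi] /= := eqVneq q i.
    exact: records_start.
  apply/recordsP/recordsP => -[ge H]; split.
  - by have := eqP adj; rewrite -val_eqE /= in qi; lia.
  - by move=> p jp; apply: H; lia.
  - lia.
  - move=> p ip pq; have [->|pi] := eqVneq p i; last first.
      by apply: H => //; have := eqP adj; rewrite -val_eqE /= in pi; lia.
    have [->//|qj] := eqVneq q j; apply: (ltn_trans uij); apply: H => //.
    by rewrite -val_eqE /= in qj; lia.
rewrite cardsU1; case: recordsP => // -[]; lia.
Qed.

Lemma card_records_swapL u i j : adjacent i j -> (u i < u j)%N ->
  #|records (swap_pos i j u) i| = #|records u j|.
Proof.
move=> adj uij; have lt := adjacent_lt adj; have aN := adjacent_neq adj.
have E q : (j < q)%N -> swap_pos i j u q = u q.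
  by move=> jq; rewrite swap_posD // -val_eqE /=; lia.
have e1 : records u j :\ j = records (swap_pos i j u) i :\ i.
  apply/setP => q; rewrite !in_setD1 -!val_eqE /=.
  apply/andP/andP => -[qN /recordsP[ge H]].
    have jq : (j < q)%N by lia.
    split; first by lia.
    apply/recordsP; split; first by lia.
    move=> p ip pq; rewrite (E q) //.
    have [->|pi] := eqVneq p i; first by rewrite swap_posL H.
    have [->|pj] := eqVneq p j; first by rewrite swap_posR (ltn_trans uij) ?H.
    by rewrite swap_posD 1?eq_sym // H //; have := eqP adj; rewrite -val_eqE /= in pi; lia.
  have qj : q != j.
    apply/eqP => qe; have := H i (leqnn _).
    by rewrite qe lt swap_posL swap_posR => /(_ isT); lia.
  have jq : (j < q)%N by apply: adjacent_gt qj; lia.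
  split; first by lia.
  apply/recordsP; split; first by lia.
  move=> p jp pq; have := H i (leqnn _); rewrite swap_posL (E q) // => Hi.
  have [->|pj] := eqVneq p j; first by apply: Hi; lia.
  have jp' : (j < p)%N by rewrite -val_eqE /= in pj; lia.
  by have := H p; rewrite (E p jp') (E q jq); apply; lia.
by rewrite (cardsD1 i) (cardsD1 j (records u j)) !records_start e1.
Qed.

Lemma card_records_swapR u i j : adjacent i j -> (u i < u j)%N ->
  (#|records u j| <= #|records (swap_pos i j u) j|)%N.
Proof.
move=> adj uij; have lt := adjacent_lt adj.
apply/subset_leq_card/subsetP => q /recordsP[jq H]; apply/recordsP; split=> // p jp pq.
rewrite [X in (_ < nat_of_ord X)%N]swap_posD -?val_eqE /=; try lia.
have [->|pj] := eqVneq p j; first by rewrite swap_posR (ltn_trans uij) ?H //; lia.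
rewrite swap_posD ?H // 1?eq_sym //; rewrite -val_eqE /=; lia.
Qed.

Lemma card_records_swap_lt u i j k : adjacent i j -> (u i < u j)%N ->
  (k < i)%N -> i \notin records u k ->
  (#|records u k| <= #|records (swap_pos i j u) k|)%N.
Proof.
move=> adj uij ki iN; have lt := adjacent_lt adj.
rewrite -(card_imset _ (@perm_inj _ (tperm i j))).
apply/subset_leq_card/subsetP => _ /imsetP[q qR ->].
have qi : q != i by apply: contraNneq iN => <-.
case/recordsP: qR => kq H; apply/recordsP.
have E p : swap_pos i j u p = u (tperm i j p) by rewrite /swap_pos permM.
have [qe|qj] := eqVneq q j.
  rewrite qe tpermR; rewrite qe in kq H; split; first exact: ltnW.
  move=> p kp pi; rewrite !E tpermL tpermD -?val_eqE /=; try lia.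
  by apply: H => //; lia.
have [iq jq] : i != q /\ j != q by rewrite ![_ == q]eq_sym.
rewrite (tpermD iq jq); split=> // p kp pq; rewrite !E (tpermD iq jq).
apply: H; move: kp pq qi qj; have := eqP adj.
  by case: tpermP => [->|->|_ _] //; lia.
by case: tpermP => [->|->|_ _] //; rewrite -!val_eqE /=; lia.
Qed.

(** By induction on the position, every entry beyond k is smaller than u k: an
    ascent beyond k would start at a record, whose entry exceeds u k. *)
Lemma records_decreasing u k :
  (forall j, adjacent k j -> (u j < u k)%N) ->
  (forall i j, adjacent i j -> (k < i)%N -> (u i < u j)%N -> i \in records u k) ->
  records u k = [set k].
Proof.
move=> dk H.
have below q : (k < q)%N -> (u q < u k)%N.
  have [d] := ubnP q; elim: d q => // d IH q qd kq.
  have q'n : (q.-1 < n)%N by have := ltn_ord q; lia.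
  have adj : adjacent (Ordinal q'n) q by rewrite /adjacent /=; lia.
  have [e|kq'] := eqVneq (Ordinal q'n) k; first by apply: dk; rewrite -e.
  have {}kq' : (k < Ordinal q'n)%N by rewrite -val_eqE /= in kq'; move=> /=; lia.
  have := IH (Ordinal q'n); rewrite /= => /(_ _ kq') lt.
  have {}lt : (u (Ordinal q'n) < u k)%N by apply: lt; lia.
  have [asc|desc] := adjacent_ascent_or u adj; last exact: ltn_trans lt.
  by case/recordsP: (H _ _ adj kq' asc) => _ /(_ k (leqnn _) kq'); rewrite ltnNge (ltnW lt).
apply/setP => q; rewrite in_set1; apply/idP/eqP => [/recordsP[kq Hq]|->]; last exact: records_start.
apply/val_inj; case: ltngtP kq => // {}kq _.
by have := Hq k (leqnn _) kq; rewrite ltnNge ltnW // below.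
Qed.

(** Let p' be the first position after k with a larger entry: the records from k
    include k and the records from p'.  Increasing subsequences from k continue at
    p' or later, hence lis at k is at most lis at p' - 1, where the entry is at
    most u k; and this by hypothesis is at most one more than lis at p'. *)
Lemma card_records_ge_lis u k :
  (forall i j, adjacent i j -> (k <= i)%N -> (lis u i <= (lis u j).+1)%N) ->
  (lis u k <= #|records u k|)%N.
Proof.
have [d] := ubnP (n - k)%N; elim: d k => // d IH k kd H.
have [l1|/lis_next[r [kr ukr er]]] := leqP (lis u k) 1.
  by apply: (leq_trans l1); apply/card_gt0P; exists k; apply: records_start.
have P0 : (k < r)%N && (u k < u r)%N by rewrite kr.
have [p' /andP[kp ukp] pmin] :=
  arg_minnP (P := fun q : 'I_n => (k < q)%N && (u k < u q)%N) (fun q => q : nat) P0.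
have kn := ltn_ord p'.
have le1 : (lis u p' <= #|records u p'|)%N.
  by apply: IH => [|i j adj pi]; [lia | apply: H => //; lia].
have le2 : ((#|records u p'|).+1 <= #|records u k|)%N.
  have kN : k \notin records u p' by apply/recordsP => -[]; lia.
  have -> : ((#|records u p'|).+1 = #|k |: records u p'|)%N by rewrite cardsU1 kN.
  apply/subset_leq_card/subsetP => q; rewrite in_setU1 => /orP[/eqP ->|].
    exact: records_start.
  move=> /recordsP[pq Hq]; apply/recordsP; split; first by lia.
  move=> p kp' pq'; have [pp'|pp'] := leqP p' p; first exact: Hq.
  have up : (u p <= u k)%N.
    rewrite leqNgt; apply/negP => ukp'.
    have {}kp' : (k < p)%N.
      by rewrite ltn_neqAle kp' andbT; apply: contraTneq ukp' => /val_inj ->; rewrite ltnn.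
    by have := pmin p; rewrite kp' ukp' => /(_ isT); lia.
  have uq : (u p' <= u q)%N.
    move: pq; rewrite leq_eqVlt => /orP[/eqP/val_inj -> //|pq].
    by apply/ltnW/Hq.
  lia.
suff : (lis u k <= (lis u p').+1)%N by lia.
have qn : (p'.-1 < n)%N by lia.
have adj : adjacent (Ordinal qn) p' by rewrite /adjacent /=; lia.
have kq : (k <= Ordinal qn)%N by move=> /=; lia.
apply: leq_trans (H _ _ adj kq).
have [->//|qk] := eqVneq (Ordinal qn) k; rewrite -er.
rewrite -val_eqE /= in qk.
apply: lis_step => /=.
  by have := pmin r; rewrite kr ukr => /(_ isT); lia.
apply: leq_ltn_trans ukr; rewrite leqNgt; apply/negP => ukq.
by have := pmin (Ordinal qn); rewrite ukq andbT /= => H'; have := H' _; lia.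
Qed.

End LeftToRightMaxima.

(** * Coefficients of isobaric divided differences *)

Section Coefficients.
Variables (n : nat) (R : idomainType).
Implicit Types (f g h : {mpoly R[n]}) (i j k : 'I_n) (r s t m : 'X_{1..n}).

Lemma mcoeff_XM i g m :
  ('X_i * g)@_m = if (0 < m i)%N then g@_(m - U_(i)) else 0.
Proof.
have [m0|m0] := ltnP.
  have e : (U_(i) + (m - U_(i)))%MM = m.
    apply/mnmP => k; rewrite mnmDE mnmBE mnm1E.
    by have [<-|_] := eqVneq i k; lia.
  by rewrite mulrC -{1}e mcoeffMX.
apply/eqP/contraT; rewrite -mcoeff_msupp mulrC (perm_mem (msuppMX _ _)).
by case/mapP => m' _ em; move: m0; rewrite em mnmDE mnm1E eqxx.
Qed.

Lemma mcoeff_XM_add i g m : ('X_i * g)@_(m + U_(i)) = g@_m.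
Proof. by rewrite mcoeff_XM mnmDE mnm1E eqxx addn1 addmK. Qed.

(** For t in Q the coefficient of the product at t + U_(i) is the difference of the
    coefficients of g at t and at t + U_(i) - U_(j), which is again in Q; induction
    on the exponent of X_j. *)
Lemma mulXB_vanish i j g (Q : 'X_{1..n} -> Prop) : i != j ->
  (forall t, Q t -> (0 < t j)%N -> Q (t + U_(i) - U_(j))%MM) ->
  (forall t, Q t -> (('X_i - 'X_j) * g)@_(t + U_(i)) = 0) ->
  forall t, Q t -> g@_t = 0.
Proof.
move=> ij Qc Q0 t; have [d] := ubnP (t j); elim: d t => // d IH t td Qt.
have := Q0 _ Qt; rewrite mulrBl mcoeffB mcoeff_XM_add mcoeff_XM.
have -> : (t + U_(i))%MM j = t j by rewrite mnmDE mnm1E (negbTE ij) addn0.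
case: ifP => tj; last by rewrite subr0.
rewrite (IH _ _ (Qc _ Qt tj)) ?subr0 // mnmBE mnmDE !mnm1E eqxx (negbTE ij).
by lia.
Qed.

Local Notation tau i j m := [multinom m (tperm i j k) | k < n].

Lemma mcoeff_idivdiff i j f m :
  (('X_i - 'X_j) * idivdiff i j f)@_m =
  f@_m - (if (0 < m j)%N then f@_(m - U_(j)) else 0) -
  f@_(tau i j m) + (if (0 < m i)%N then f@_(tau i j (m - U_(i))%MM) else 0).
Proof.
rewrite idivdiffE !mulrBl !mul1r !mcoeffB !mcoeff_XM !mcoeff_sym opprB addrA.
by rewrite addrAC.
Qed.

(** The four coefficients are those that make up the coefficient of
    (1 - X_j) f - (1 - X_i) (s f) at t + U_(i), where s exchanges X_i and X_j. *)
Lemma idivdiff_vanishL i j f (Q : 'X_{1..n} -> Prop) : i != j ->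
  (forall t, Q t -> (0 < t j)%N -> Q (t + U_(i) - U_(j))%MM) ->
  (forall t, Q t -> [/\ f@_(t + U_(i)) = 0,
     (0 < t j)%N -> f@_(t + U_(i) - U_(j)) = 0,
     f@_(tau i j (t + U_(i))%MM) = 0 & f@_(tau i j t) = 0]) ->
  forall t, Q t -> (idivdiff i j f)@_t = 0.
Proof.
move=> ij Qc Q0; apply: (mulXB_vanish (i := i) (j := j)) => // t Qt.
rewrite mcoeff_idivdiff; have [-> e2 -> e4] := Q0 _ Qt.
rewrite addmK e4 if_same mnmDE mnm1E (negbTE ij) addn0.
by case: ifP => [/e2 ->|_]; rewrite !subr0 addr0.
Qed.

(** As idivdiff_vanishL with the coefficient at t + U_(j), for sets of exponents
    closed under moving a unit from i to j. *)
Lemma idivdiff_vanishR i j f (Q : 'X_{1..n} -> Prop) : i != j ->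
  (forall t, Q t -> (0 < t i)%N -> Q (t + U_(j) - U_(i))%MM) ->
  (forall t, Q t -> [/\ f@_(t + U_(j)) = 0, f@_t = 0,
     f@_(tau i j (t + U_(j))%MM) = 0 &
     (0 < t i)%N -> f@_(tau i j (t + U_(j) - U_(i))%MM) = 0]) ->
  forall t, Q t -> (idivdiff i j f)@_t = 0.
Proof.
move=> ij Qc Q0; apply: (mulXB_vanish (i := j) (j := i)) => //; first by rewrite eq_sym.
move=> t Qt; rewrite -opprB mulNr mcoeffN mcoeff_idivdiff.
have [-> e2 -> e4] := Q0 _ Qt.
rewrite addmK e2 if_same mnmDE mnm1E eq_sym (negbTE ij) addn0.
by case: ifP => [/e4 ->|_]; rewrite !subr0 addr0 oppr0.
Qed.

Lemma mdeg_tau i j m : mdeg (tau i j m) = mdeg m.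
Proof. exact: mdeg_mperm. Qed.

Lemma mdeg_shift i j m : (0 < m j)%N -> mdeg (m + U_(i) - U_(j))%MM = mdeg m.
Proof.
move=> mj; have e : ((m + U_(i) - U_(j)) + U_(j))%MM = (m + U_(i))%MM.
  apply/mnmP => k; rewrite !(mnmDE, mnmBE) !mnm1E.
  by have [<-|_] := eqVneq j k; lia.
by have := congr1 (@mdeg n) e; rewrite !mdegD !mdeg1 => /addIn.
Qed.

Lemma eq0_of_bound f (P : 'X_{1..n} -> Prop) m :
  (forall s, f@_s != 0 -> P s) -> ~ P m -> f@_m = 0.
Proof. by move=> fP; have [//|/fP] := eqVneq f@_m 0. Qed.

Lemma idivdiff_mdeg_lt i j f d : i != j ->
  (forall s, f@_s != 0 -> (mdeg s < d)%N) ->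
  forall t, (idivdiff i j f)@_t != 0 -> (mdeg t < d)%N.
Proof.
move=> ij fd t; rewrite ltnNge; apply: contraNN => dt.
apply/eqP; move: t dt; apply: idivdiff_vanishL => // t dt.
  by move=> tj; rewrite mdeg_shift.
have ge s : (d <= mdeg s)%N -> f@_s = 0.
  by move=> ds; apply: (eq0_of_bound fd); rewrite ltnNge ds.
by split => [|tj||]; apply: ge; rewrite ?mdeg_tau ?mdeg_shift // mdegD; lia.
Qed.

(** The numerator (1 - X_j) f - (1 - X_i) (s f) has degree at most D + 1 in X_i,
    and the division by X_i - X_j lowers this degree by one. *)
Lemma idivdiff_degL i j f D : i != j ->
  (forall s, f@_s != 0 -> (s i <= D.+1)%N) ->
  (forall s, f@_s != 0 -> (s j <= D)%N) ->
  forall t, (idivdiff i j f)@_t != 0 -> (t i <= D)%N.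
Proof.
move=> ij fi fj t; rewrite leqNgt; apply: contraNN => dt.
apply/eqP; move: t dt; apply: idivdiff_vanishL => // t dt.
  by move=> tj; rewrite mnmBE mnmDE !mnm1E eqxx eq_sym (negbTE ij); lia.
have gei s : (D.+1 < s i)%N -> f@_s = 0.
  by move=> ds; apply: (eq0_of_bound fi); rewrite leqNgt ds.
have gej s : (D < s j)%N -> f@_s = 0.
  by move=> ds; apply: (eq0_of_bound fj); rewrite leqNgt ds.
split => [|tj||].
- by apply: gei; rewrite mnmDE mnm1E eqxx; lia.
- by apply: gei; rewrite mnmBE mnmDE !mnm1E eqxx eq_sym (negbTE ij); lia.
- by apply: gej; rewrite mnmE tpermR mnmDE; lia.
- by apply: gej; rewrite mnmE tpermR.
Qed.

Lemma idivdiff_degR i j f D : i != j ->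
  (forall s, f@_s != 0 -> (s i <= D.+1)%N) ->
  (forall s, f@_s != 0 -> (s j <= D)%N) ->
  forall t, (idivdiff i j f)@_t != 0 -> (t j <= D)%N.
Proof.
move=> ij fi fj t; rewrite leqNgt; apply: contraNN => dt.
apply/eqP; move: t dt; apply: idivdiff_vanishR => // t dt.
  by move=> tj; rewrite mnmBE mnmDE !mnm1E eqxx (negbTE ij); lia.
have gei s : (D.+1 < s i)%N -> f@_s = 0.
  by move=> ds; apply: (eq0_of_bound fi); rewrite leqNgt ds.
have gej s : (D < s j)%N -> f@_s = 0.
  by move=> ds; apply: (eq0_of_bound fj); rewrite leqNgt ds.
split => [|||ti].
- by apply: gej; rewrite mnmDE; lia.
- exact: gej.
- by apply: gei; rewrite mnmE tpermL mnmDE mnm1E eqxx; lia.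
- by apply: gei; rewrite mnmE tpermL mnmBE mnmDE !mnm1E eqxx (negbTE ij); lia.
Qed.

Lemma idivdiff_deg_other i j k f D : i != j -> k != i -> k != j ->
  (forall s, f@_s != 0 -> (s k <= D)%N) ->
  forall t, (idivdiff i j f)@_t != 0 -> (t k <= D)%N.
Proof.
move=> ij ki kj fk t; rewrite leqNgt; apply: contraNN => dt.
have [ik jk] : i != k /\ j != k by rewrite ![_ == k]eq_sym.
apply/eqP; move: t dt; apply: idivdiff_vanishL => // t dt.
  by move=> tj; rewrite mnmBE mnmDE !mnm1E (negbTE ik) (negbTE jk); lia.
have gek s : (D < s k)%N -> f@_s = 0.
  by move=> ds; apply: (eq0_of_bound fk); rewrite leqNgt ds.
split => [|tj||]; apply: gek; rewrite ?mnmE ?tpermD //;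
  rewrite ?(mnmBE, mnmDE) ?mnm1E ?(negbTE ik) ?(negbTE jk); lia.
Qed.

Definition prefix_sum m (k : nat) : nat := \sum_(q < n | (q < k)%N) m q.

Definition dominates s r := forall k : nat, (prefix_sum r k <= prefix_sum s k)%N.

Lemma prefix_sumS m i : prefix_sum m i.+1 = (prefix_sum m i + m i)%N.
Proof.
rewrite /prefix_sum (bigD1 i) //= addnC; congr (_ + _)%N; apply: eq_bigl => q.
by rewrite ltnS [RHS]ltn_neqAle andbC val_eqE.
Qed.

Lemma prefix_sum_eq i j s t : adjacent i j ->
  (forall k, k != i -> k != j -> s k = t k) -> (s i + s j = t i + t j)%N ->
  forall k : nat, k != i.+1 -> prefix_sum s k = prefix_sum t k.
Proof.
move=> adj e1 e2 k ki; have aN := adjacent_neq adj; have ij := eqP adj.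
have [le|lt] := leqP k i.
  by apply: eq_bigr => q qk; apply: e1; rewrite -val_eqE /=; lia.
have [ik jk] : (i < k)%N /\ (j < k)%N by lia.
have jP : (j < k)%N && (j != i) by rewrite jk eq_sym.
rewrite /prefix_sum !(bigD1 (P := fun q : 'I_n => (q < k)%N) i) //= !(bigD1 j jP) /=.
rewrite !addnA e2; congr (_ + _)%N.
by apply: eq_bigr => q /andP[/andP[_ qi] qj]; apply: e1.
Qed.

Lemma prefix_sum_total m : prefix_sum m n = mdeg m.
Proof. by rewrite mdegE; apply: eq_bigl => q; rewrite ltn_ord. Qed.

Lemma dominates_anti s t : dominates s t -> dominates t s -> s = t.
Proof.
move=> st ts; apply/mnmP => i.
have e (k : nat) : prefix_sum s k = prefix_sum t k by apply/eqP; rewrite eqn_leq st ts.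
by have := e i.+1; rewrite !prefix_sumS e => /addnI.
Qed.

Lemma prefix_sum_shift i j t : adjacent i j -> (0 < t i)%N ->
  let s := (t + U_(j) - U_(i))%MM in
  (prefix_sum s i.+1 < prefix_sum t i.+1)%N /\ forall k : nat, (prefix_sum s k <= prefix_sum t k)%N.
Proof.
move=> adj ti; have ij := adjacent_neq adj; set s := (t + _ - _)%MM.
have si : s i = (t i).-1 by rewrite mnmBE mnmDE !mnm1E eqxx eq_sym (negbTE ij); lia.
have sj : s j = (t j).+1 by rewrite mnmBE mnmDE !mnm1E eqxx (negbTE ij); lia.
have sD q : q != i -> q != j -> s q = t q.
  by rewrite mnmBE mnmDE !mnm1E ![q == _]eq_sym => /negbTE -> /negbTE ->; lia.
have Pst (k : nat) : k != i.+1 -> prefix_sum s k = prefix_sum t k.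
  by apply: (prefix_sum_eq adj sD); rewrite si sj; lia.
have lt : (prefix_sum s i.+1 < prefix_sum t i.+1)%N.
  by rewrite !prefix_sumS si Pst 1?ltn_eqF //; lia.
split=> // k; have [->|ki] := eqVneq k i.+1; first exact: ltnW.
by rewrite Pst.
Qed.

Section Transfer.
Variables (i j : 'I_n) (r r' : 'X_{1..n}) (f : {mpoly R[n]}).
Hypotheses (adj : adjacent i j) (rij : (r i <= r j)%N) (rj0 : (0 < r i)%N).
Hypotheses (r'i : r' i = (r j).+1) (r'j : r' j = (r i).-1).
Hypothesis r'D : forall k, k != i -> k != j -> r' k = r k.
Hypothesis f_deg : forall s, f@_s != 0 -> (mdeg s <= mdeg r)%N.
Hypothesis f_dom : forall s, f@_s != 0 -> mdeg s = mdeg r -> dominates s r'.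
Hypothesis f_i : forall s, f@_s != 0 -> (s i <= (r j).+1)%N.

Lemma prefix_sum_r' (k : nat) : k != i.+1 -> prefix_sum r' k = prefix_sum r k.
Proof. by apply: (prefix_sum_eq adj r'D); rewrite r'i r'j; lia. Qed.

Let bad t := (mdeg r < mdeg t)%N \/ mdeg t = mdeg r /\ ~ dominates t r.

Let tau_shift t : (0 < t i)%N ->
  let s := tau i j (t + U_(j) - U_(i))%MM in
  [/\ s i = (t j).+1, s j = (t i).-1 & forall k, k != i -> k != j -> s k = t k].
Proof.
have ij := adjacent_neq adj.
move=> ti; split=> [||k ki kj]; rewrite mnmE ?tpermL ?tpermR mnmBE mnmDE !mnm1E.
- by rewrite eqxx (negbTE ij); lia.
- by rewrite eqxx eq_sym (negbTE ij); lia.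
- by have [ik jk] : i != k /\ j != k; rewrite ?[_ == k]eq_sym // tpermD // (negbTE ik) (negbTE jk); lia.
Qed.

(** In degree |r| the coefficient at t is governed by two coefficients of f: that
    at t, and that at the exponent s with s_i = t_j + 1 and s_j = t_i - 1.  If s
    occurs in f then it dominates r', and s_i <= r_j + 1 then bounds the prefix
    sum of t at i + 1 from below, so that t dominates r. *)
Lemma idivdiff_dominates t : (idivdiff i j f)@_t != 0 ->
  (mdeg t <= mdeg r)%N /\ (mdeg t = mdeg r -> dominates t r).
Proof.
have ij := adjacent_neq adj.
have gt s : (mdeg r < mdeg s)%N -> f@_s = 0.
  by move=> ds; apply: (eq0_of_bound f_deg); rewrite leqNgt ds.
have vanish : forall t, bad t -> (idivdiff i j f)@_t = 0; last first.
  move=> t0; have nb : ~ bad t by move=> /vanish e; rewrite e eqxx in t0.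
  split; first by rewrite leqNgt; apply/negP => lt; apply: nb; left.
  move=> e k; rewrite leqNgt; apply/negP => lt; apply: nb; right; split=> //.
  by move=> /(_ k); rewrite leqNgt lt.
apply: idivdiff_vanishR => // {}t.
  case=> [dt|[dt nd]] ti; [left|right]; rewrite mdeg_shift //; split=> // D; apply: nd => k.
  by apply: leq_trans (D k) _; have [_] := prefix_sum_shift adj ti; apply.
case=> [dt|[dt nd]].
  by split => [|||ti]; apply: gt; rewrite ?mdeg_tau ?mdeg_shift // mdegD; lia.
split => [|||ti].
- by apply: gt; rewrite mdegD mdeg1; lia.
- apply: (eq0_of_bound f_dom) => /(_ dt) D; apply: nd => k.
  apply: leq_trans (D k); have [->|/prefix_sum_r' -> //] := eqVneq k i.+1.
  by rewrite !prefix_sumS prefix_sum_r' 1?ltn_eqF // r'i; lia.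
- by apply: gt; rewrite mdeg_tau mdegD mdeg1; lia.
- have [si sj sD] := tau_shift ti; set s := tau i j _ in si sj sD *.
  have ds : mdeg s = mdeg r by rewrite mdeg_tau mdeg_shift.
  have [//|f0] := eqVneq f@_s 0; case: nd => k.
  have sij : (s i + s j = t i + t j)%N by rewrite si sj; lia.
  have Pst := prefix_sum_eq adj sD sij.
  have [->|ki] := eqVneq k i.+1; last first.
    by rewrite -Pst // -prefix_sum_r' //; apply: f_dom.
  have := f_dom f0 ds j.+1; have := f_i f0.
  rewrite prefix_sum_r' 1?Pst; try by rewrite (eqP adj); lia.
  by rewrite !prefix_sumS (eqP adj) !prefix_sumS si; lia.
Qed.

(** Of the coefficients that enter the numerator at r + U_(j), the one at r is
    zero because r does not dominate r', and those of degree |r| + 1 are zero; what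
    remains is the coefficient at r'. *)
Lemma idivdiff_lead : (idivdiff i j f)@_r = - f@_r'.
Proof.
have ij := adjacent_neq adj.
have gt s : (mdeg r < mdeg s)%N -> f@_s = 0.
  by move=> ds; apply: (eq0_of_bound f_deg); rewrite leqNgt ds.
have nd t : mdeg t = mdeg r -> (prefix_sum t i.+1 < prefix_sum r i.+1)%N ->
    (idivdiff i j f)@_t = 0.
  move=> dt lt; have [//|ne] := eqVneq (idivdiff i j f)@_t 0.
  by have [_ /(_ dt)/(_ i.+1)] := idivdiff_dominates ne; rewrite leqNgt lt.
have fr : f@_r = 0.
  apply: (eq0_of_bound f_dom) => /(_ erefl)/(_ i.+1).
  by rewrite !prefix_sumS prefix_sum_r' 1?ltn_eqF // r'i; lia.
have := mcoeff_idivdiff i j f (r + U_(j))%MM.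
rewrite mulrBl mcoeffB mcoeff_XM_add mcoeff_XM.
have -> : (r + U_(j))%MM i = r i by rewrite mnmDE mnm1E eq_sym (negbTE ij) addn0.
have -> : (r + U_(j))%MM j = (r j).+1 by rewrite mnmDE mnm1E eqxx addn1.
rewrite rj0 /= addmK fr (nd (r + U_(j) - U_(i))%MM); first last.
- by have [] := prefix_sum_shift adj rj0.
- by rewrite mdeg_shift.
rewrite (gt (r + U_(j))%MM) ?mdegD ?mdeg1 ?addn1 //.
rewrite (gt (tau i j (r + U_(j))%MM)) ?mdeg_tau ?mdegD ?mdeg1 ?addn1 //.
rewrite !subr0 ?sub0r ?add0r.
have -> : tau i j (r + U_(j) - U_(i))%MM = r'.
  have [si sj sD] := tau_shift rj0; apply/mnmP => k.
  have [->|ki] := eqVneq k i; first by rewrite si r'i.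
  have [->|kj] := eqVneq k j; first by rewrite sj r'j.
  by rewrite sD // r'D.
by move=> <-; rewrite opprK.
Qed.

End Transfer.
End Coefficients.

(** * Sign-coherent products and pipe dreams of large weight *)

Section Coherence.
Variable n : nat.
Local Notation T := {ffun 'S_n -> {mpoly int[n]}}.
Implicit Types (f : T) (p u : 'S_n) (a b k : 'I_n) (s : 'X_{1..n}).

(** Normalized by the sign that a pipe dream of weight s for p^-1 carries; the
    parity of p stands for that of its number of inversions. *)
Definition signed_coeff f p s : int := (-1) ^+ (mdeg s + odd_perm p) * (f p)@_s.

Definition coherent f := forall p s, 0 <= signed_coeff f p s.

(** After normalization the three terms of (1 - X_k) f(p) + X_k f(p') are added: the
    minus sign is compensated by the change of degree, and in the last term the
    changes of degree and of parity cancel. *)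
Lemma signed_coeff_hecke_op a b k f p s : a != b -> (p b < p a)%N ->
  signed_coeff (hecke_op a b 'X_k f) p s = signed_coeff f p s +
  (if (0 < s k)%N then signed_coeff f p (s - U_(k))%MM +
     signed_coeff f (swap_pos a b p) (s - U_(k))%MM else 0).
Proof.
move=> ab desc; rewrite /signed_coeff hecke_opE desc mulrBl mul1r.
rewrite !(mcoeffD, mcoeffN) !mcoeff_XM /swap_pos odd_permM odd_tperm ab.
case: ifP => sk; last by rewrite subr0 !addr0.
have -> : mdeg s = (mdeg (s - U_(k))%MM).+1.
  have e : s = (s - U_(k) + U_(k))%MM.
    by apply/mnmP => q; rewrite mnmDE mnmBE mnm1E; have [e|_] := eqVneq k q; rewrite ?addn0 ?subn0 // -e addn1 subn1 prednK.
  by rewrite {1}e mdegD mdeg1 addn1.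
by rewrite addSn exprS; case: (odd_perm p) => /=; rewrite ?addn0 ?addn1 ?exprS; ring.
Qed.

Lemma coherent_hecke_op a b k f : a != b -> coherent f -> coherent (hecke_op a b 'X_k f).
Proof.
move=> ab cf p s; have [desc|asc] := boolP (p b < p a)%N; last first.
  by rewrite /signed_coeff hecke_opE (negbTE asc); apply: cf.
rewrite signed_coeff_hecke_op //; apply: addr_ge0 => //.
by case: ifP => // _; apply: addr_ge0.
Qed.

(** Together with the next two lemmas, the three ways to extend a pipe dream by one
    factor: omit it, use it without effect on the permutation, or use it to
    switch two values. *)
Lemma hecke_op_pos_stay a b k f p s : a != b -> coherent f ->
  0 < signed_coeff f p s -> 0 < signed_coeff (hecke_op a b 'X_k f) p s.
Proof.
move=> ab cf; have [desc|asc] := boolP (p b < p a)%N; last first.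
  by rewrite /signed_coeff hecke_opE (negbTE asc).
rewrite signed_coeff_hecke_op // => f0; apply: ltr_wpDr => //.
by case: ifP => // _; apply: addr_ge0.
Qed.

Lemma hecke_op_pos_keep a b k f p s : a != b -> coherent f -> (p b < p a)%N ->
  0 < signed_coeff f p s -> 0 < signed_coeff (hecke_op a b 'X_k f) p (s + U_(k))%MM.
Proof.
move=> ab cf desc f0; rewrite signed_coeff_hecke_op // mnmDE mnm1E eqxx addn1 /= addmK.
by apply: ltr_wpDl => //; apply: ltr_wpDr.
Qed.

Lemma hecke_op_pos_swap a b k f p s : a != b -> coherent f -> (p b < p a)%N ->
  0 < signed_coeff f (swap_pos a b p) s ->
  0 < signed_coeff (hecke_op a b 'X_k f) p (s + U_(k))%MM.
Proof.
move=> ab cf desc f0; rewrite signed_coeff_hecke_op // mnmDE mnm1E eqxx addn1 /= addmK.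
by apply: ltr_wpDl => //; apply: ltr_wpDl.
Qed.

End Coherence.

Section Reach.
Variable N : nat.
Local Notation K := {mpoly int[N.+1]}.
Local Notation T := {ffun 'S_N.+1 -> K}.
Local Notation o j := (inord j : 'I_N.+1).
Implicit Types (f : T) (p u v : 'S_N.+1) (c q : 'I_N.+1) (s : 'X_{1..N.+1}).

Definition partial_row m e (x : K) f : T :=
  foldl (fun g j => hecke_at j x g) f (iota m e).

Lemma partial_rowS m e x f :
  partial_row m e.+1 x f = hecke_at (m + e) x (partial_row m e x f).
Proof. by rewrite /partial_row -[e.+1]addn1 iotaD foldl_cat. Qed.

Lemma coherent_partial_row m e k f : (m + e <= N)%N -> coherent f ->
  coherent (partial_row m e 'X_k f).
Proof.
elim: e => // e IH me cf; rewrite partial_rowS; apply: coherent_hecke_op.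
  by apply: adjacent_neq; apply: adjacent_inord; lia.
by apply: IH => //; lia.
Qed.

Definition fixes_below (m : nat) u := forall k : 'I_N.+1, (k < m)%N -> u k = k.

Lemma fixes_below_ge m u q : fixes_below m u -> (m <= u q)%N = (m <= q)%N.
Proof.
move=> fu; apply/idP/idP => h; rewrite leqNgt; apply/negP => lt.
  by move: h; rewrite (fu _ lt) leqNgt lt.
by have /perm_inj e := fu _ lt; move: h; rewrite -[q]e leqNgt lt.
Qed.

(** One row of a pipe dream for u with few omitted factors.  The factors are
    treated from the last one down; position c carries the value m + e, and q is
    the position of the value just below it.  If q < c, the factor is omitted and
    q carries on.  If c < q and lis at c is at most lis at q, the factor is used
    without effect and q carries on.  Otherwise it switches the two values, which
    preserves lis, and c carries on.  The value of lis at the carrying position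
    never decreases and grows at each omission, so that there are at most
    lis u m - lis u c omissions.  The carrying position ends up at m: it gets there
    when the carried value comes down to u(m), and then every factor switches. *)
Lemma reach_row m f (x := 'X_(o m)) : (m <= N)%N -> coherent f ->
  forall e u c, (m + e <= N)%N -> fixes_below m u -> u c = (m + e)%N :> nat ->
  c = o m \/ (u (o m) < m + e)%N ->
  exists v d, [/\ fixes_below m.+1 v, forall q, (m < q)%N -> lis v q = lis u q,
    (e + lis u c <= d + lis u (o m))%N &
    forall s, 0 < signed_coeff f v^-1%g s ->
      0 < signed_coeff (partial_row m e x f) u^-1%g (s + U_(o m) *+ d)%MM].
Proof.
move=> mN cf; have om : o m = m :> nat by rewrite inordK.
elim=> [|e IH] u c me fu uc cond.
  have ec : c = o m.
    case: cond => // lt; have : (m <= u (o m))%N by rewrite (fixes_below_ge _ fu) om.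
    by rewrite leqNgt -[X in (_ < X)%N]addn0 lt.
  exists u, 0%N; split=> //; last by move=> s; rewrite mulm0n addm0.
    move=> k; rewrite ltnS leq_eqVlt => /orP[/eqP km|]; last exact: fu.
    have -> : k = c by rewrite ec; apply: val_inj; rewrite /= om.
    by apply: val_inj; rewrite /= uc ec om addn0.
  by rewrite ec.
have jN : (m + e < N)%N by lia.
set j := (m + e)%N in jN *; set a := o j; set b := o j.+1.
have aE : a = j :> nat by rewrite inordK //; lia.
have bE : b = j.+1 :> nat by rewrite inordK //; lia.
have abN : a != b by rewrite -val_eqE /= aE bE; lia.
have ub : u c = b by apply: val_inj; rewrite /= uc bE addnS.
pose q := (u^-1)%g a; have uq : u q = a by rewrite permKV.
have qE : (u^-1)%g b = c by rewrite -ub permK.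
have mc : (m <= c)%N by rewrite -(fixes_below_ge _ fu) ub bE /j; lia.
have mq : (m <= q)%N by rewrite -(fixes_below_ge _ fu) uq aE /j; lia.
have cq : c != q by apply: contraNneq abN => e'; rewrite -ub -uq e'.
have uN r : r != q -> u r != a by rewrite -uq (inj_eq perm_inj).
have uN' r : r != c -> u r != b by rewrite -ub (inj_eq perm_inj).
have cpe : coherent (partial_row m e x f) by apply: coherent_partial_row => //; lia.
pose u' := (u * tperm a b)%g.
have u'E r : u' r = tperm a b (u r) by rewrite permM.
have u'V : (u'^-1 = swap_pos a b u^-1)%g by rewrite invMg tpermV.
have fu' : fixes_below m u'.
  move=> k km; rewrite u'E fu // tpermD // -val_eqE /= ?aE ?bE /j; lia.
have swap_step v d : (c < q)%N ->
    (forall s, 0 < signed_coeff f v^-1%g s ->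
      0 < signed_coeff (partial_row m e x f) u'^-1%g (s + U_(o m) *+ d)%MM) ->
    forall s, 0 < signed_coeff f v^-1%g s ->
      0 < signed_coeff (partial_row m e.+1 x f) u^-1%g (s + U_(o m) *+ d.+1)%MM.
  move=> lt H s /H; rewrite u'V partial_rowS mulmSr addmA => H'.
  by apply: hecke_op_pos_swap => //; rewrite qE.
(* The carrying position is m: the factor switches, whatever lis is there. *)
have [ec|cN] := eqVneq c (o m).
  have lt : (c < q)%N.
    by rewrite ltn_neqAle (_ : (c != q :> nat)) // ec om.
  have u'c : u' (o m) = j :> nat by rewrite -ec u'E ub tpermR aE.
  have [||||v [d [fv lv led posv]]] := IH u' (o m) => //; [lia|by left|].
  exists v, d.+1; split=> //; last exact: swap_step.
    move=> r mr; rewrite lv //; apply: (lis_eq_from (m := m.+1)) => //.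
      move=> p1 p2 mp1 p12; rewrite !u'E.
      have /uN' : p1 != c by rewrite -val_eqE /= ec om; lia.
      have /uN' : p2 != c by rewrite -val_eqE /= ec om; lia.
      by rewrite -!val_eqE /= !bE; case: tpermP => [->|->|/eqP + /eqP +];
        case: tpermP => [->|->|/eqP + /eqP +]; rewrite -?val_eqE /= ?aE ?bE; lia.
    move=> p1 p2 mp1 p12 lt'; apply: lis_step => //; move: lt'; rewrite !u'E.
    have /uN' : p1 != c by rewrite -val_eqE /= ec om; lia.
    have /uN' : p2 != c by rewrite -val_eqE /= ec om; lia.
    by rewrite -!val_eqE /= !bE; case: tpermP => [->|->|/eqP + /eqP +];
      case: tpermP => [->|->|/eqP + /eqP +]; rewrite -?val_eqE /= ?aE ?bE; lia.
  by rewrite ec; lia.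
have um : (u (o m) <= j)%N.
  by case: cond => [e'|]; [rewrite e' eqxx in cN | rewrite /j addnS ltnS].
(* The value below lies to the left: the factor is omitted. *)
have [lt|ge] := ltnP c q; last first.
  have lt : (q < c)%N by rewrite ltn_neqAle ge andbT eq_sym.
  have cond' : q = o m \/ (u (o m) < j)%N.
    have [e'|ne] := eqVneq (u (o m)) a; first by left; rewrite /q -e' permK.
    by right; rewrite -val_eqE /= aE in ne; lia.
  have [||v [d [fv lv led posv]]] := IH u q _ fu _ cond'; [lia|by rewrite uq aE|].
  exists v, d; split=> // [|s /posv].
    have : (lis u c < lis u q)%N by apply: lis_step; rewrite // ub uq aE bE.
    by lia.
  by rewrite partial_rowS; apply: hecke_op_pos_stay.
have qm : q != o m by rewrite -val_eqE /= om; lia.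
have umj : (u (o m) < j)%N.
  have := uN (o m); rewrite eq_sym => /(_ qm); rewrite -val_eqE /= aE; lia.
(* The factor is used without effect, and q carries on. *)
have [le|gt] := leqP (lis u c) (lis u q).
  have [||v [d [fv lv led posv]]] := IH u q _ fu _ (or_intror umj);
    [lia|by rewrite uq aE|].
  exists v, d.+1; split=> // [|s /posv]; first by lia.
  rewrite partial_rowS mulmSr addmA => H'.
  by apply: hecke_op_pos_keep => //; rewrite qE.
(* The factor switches; the new noninversion c < q is harmless for lis. *)
have lisE : forall r : 'I_N.+1, (m <= r)%N -> lis u' r = lis u r.
  apply: lis_eq_from => p1 p2 mp1 p12; rewrite !u'E.
    have N12 : ~~ ((p1 == q) && (p2 == c)).
      by apply/andP => -[/eqP e1 /eqP e2]; move: p12; rewrite e1 e2; lia.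
    have : ~~ ((u p1 == a) && (u p2 == b)).
      by rewrite -uq -ub !(inj_eq perm_inj).
    by rewrite -!val_eqE /= aE bE; case: tpermP => [->|->|/eqP + /eqP +];
        case: tpermP => [->|->|/eqP + /eqP +]; rewrite -?val_eqE /= ?aE ?bE; lia.
  have [/andP[/eqP -> /eqP -> _]//|N12] := boolP ((p1 == c) && (p2 == q)).
  move=> lt'; apply: lis_step => //; move: lt'.
  have : ~~ ((u p1 == b) && (u p2 == a)).
    by rewrite -uq -ub !(inj_eq perm_inj).
  by rewrite -!val_eqE /= aE bE; case: tpermP => [->|->|/eqP + /eqP +];
      case: tpermP => [->|->|/eqP + /eqP +]; rewrite -?val_eqE /= ?aE ?bE; lia.
have u'm : u' (o m) = u (o m).
  by rewrite u'E tpermD // -val_eqE /= ?aE ?bE; lia.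
have [||||v [d [fv lv led posv]]] := IH u' c => //; first by lia.
- by rewrite u'E ub tpermR aE.
- by right; rewrite u'm.
exists v, d.+1; split=> //; last exact: swap_step.
  by move=> r mr; rewrite lv // lisE // ltnW.
by move: led; rewrite !lisE ?om //; lia.
Qed.

(** Beyond N, inord would return the index 0 of another variable. *)
Definition row_var k : K := if (k <= N)%N then 'X_(o k) else 0.

Lemma coherent_rows m : coherent (rows N row_var m).
Proof.
have [d] := ubnP (N.+1 - m)%N; elim: d m => // d IH m md.
have [mN|mN] := ltnP N m.
  rewrite rows_gt // => p s; rewrite /signed_coeff ffunE.
  have [->|_] := eqVneq p 1%g; last by rewrite mcoeff0 mulr0.
  rewrite odd_perm1 addn0 mcoeff1; have [->|_] := eqVneq s 0%MM; last by rewrite mulr0.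
  by rewrite mdeg0.
rewrite rows_rec /row_var mN; apply: coherent_partial_row; first by lia.
by apply: IH; lia.
Qed.

(** A row has N - m factors, of which reach_row, started at the position of the
    greatest value, omits at most lis u m - 1: at least
    raj u m factors are used. *)
Lemma reach_rows m u : fixes_below m u -> exists2 s,
  0 < signed_coeff (rows N row_var m) u^-1%g s &
  forall k : 'I_N.+1, (m <= k)%N -> (raj u k <= s k)%N.
Proof.
have [d] := ubnP (N.+1 - m)%N; elim: d m u => // d IH m u md fu.
have [mN|mN] := ltnP N m.
  exists 0%MM => [|k mk]; last by have := ltn_ord k; lia.
  have -> : u = 1%g.
    by apply/permP => k; rewrite perm1 fu //; have := ltn_ord k; lia.
  by rewrite rows_gt // /signed_coeff ffunE invg1 eqxx odd_perm1 mdeg0 mcoeff1 eqxx.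
pose c := (u^-1)%g (o N); have uc : u c = (m + (N - m))%N :> nat.
  by rewrite permKV inordK // subnKC.
have cond : c = o m \/ (u (o m) < m + (N - m))%N.
  have [e|ne] := eqVneq (u (o m)) (o N); first by left; rewrite /c -e permK.
  by right; have := ltn_ord (u (o m)); rewrite -val_eqE /= inordK // in ne; lia.
have [|v [e [fv lv led posv]]] :=
  @reach_row m (rows N row_var m.+1) mN (coherent_rows _) (N - m)%N u c _ fu uc cond.
  by lia.
have [|s /posv s0 sr] := IH m.+1 v _ fv; first by lia.
exists (s + U_(o m) *+ e)%MM; first by rewrite rows_rec /row_var mN.
move=> k; rewrite mnmDE mulmnE mnm1E leq_eqVlt => /orP[/eqP mk|mk].
  have -> : k = o m by apply: val_inj; rewrite /= inordK.
  rewrite eqxx rajE; have := lis_gt0 u c; rewrite inordK //; lia.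
apply: leq_trans (leq_addr _ _); rewrite rajE -lv // -rajE.
exact: sr.
Qed.

End Reach.

(** * The pipe dream formula *)

Section LongestElement.
Variables (N : nat) (K : idomainType).
Local Notation T := {ffun 'S_N.+1 -> K}.
Local Notation o j := (inord j : 'I_N.+1).
Implicit Types (f : T) (x c : K) (p : 'S_N.+1) (xi : nat -> K).

Lemma inv_w0 : Defs.inv (w0 N.+1) = (\sum_(0 <= k < N.+1) (N - k))%N.
Proof.
rewrite invE; transitivity (\sum_(p : 'I_N.+1 * 'I_N.+1 | (p.1 < p.2)%N) 1)%N.
  apply: eq_bigr => -[i j] /= ij; rewrite !permE /=; apply/eqP; rewrite eqb1.
  by have := ltn_ord i; have := ltn_ord j; lia.
rewrite -(pair_big_dep xpredT (fun i j : 'I_N.+1 => (i < j)%N) (fun _ _ => 1%N)) /=.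
rewrite big_mkord; apply: eq_bigr => i _.
rewrite -(big_geq_mkord i.+1 N.+1 xpredT (fun=> 1%N)).
by rewrite sum_nat_const_nat muln1 subSS.
Qed.

(** What holds after t factors with product of variables c: a permutation with t
    inversions needs all of them, each used to switch. *)
Definition top_length t c f := forall p,
  ((t < Defs.inv p)%N -> f p = 0) /\ (Defs.inv p = t -> f p = 0 \/ f p = c).

Lemma top_length_hecke_op a b t c x f : adjacent a b -> top_length t c f ->
  top_length t.+1 (x * c) (hecke_op a b x f).
Proof.
move=> ab tf p; rewrite hecke_opE; case: ifP => [desc|_]; last first.
  by split=> [lt|e]; [apply: (tf p).1; lia | left; apply: (tf p).1; lia].
have e : Defs.inv p = (Defs.inv (swap_pos a b p)).+1.
  by rewrite -(inv_swap_pos ab) ?swap_posK // swap_posL swap_posR.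
split=> [lt|et].
  by rewrite (tf p).1 ?(tf (swap_pos a b p)).1 ?mulr0 ?addr0 //; lia.
rewrite (tf p).1; last by lia.
have [|->|->] := (tf (swap_pos a b p)).2; first by lia.
  by left; rewrite !mulr0 addr0.
by right; rewrite mulr0 add0r.
Qed.

Lemma top_length_row m t c x f : top_length t c f ->
  top_length (N - m + t) (x ^+ (N - m) * c) (row_op m x f).
Proof.
elim/(@down_ind N): m t c f => m mN => [|IH] t c f tf.
  by rewrite row_op_ge // (_ : N - m = 0)%N ?mul1r //; apply/eqP; rewrite subn_eq0.
rewrite (row_op_rec _ _ mN) -(subnSK mN) exprSr -mulrA addSnnS.
by apply/IH/top_length_hecke_op => //; apply: adjacent_inord.
Qed.

Lemma top_length_rows xi m :
  top_length (\sum_(m <= k < N.+1) (N - k))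
    (\prod_(m <= k < N.+1) xi k ^+ (N - k)) (rows N xi m).
Proof.
have [d] := ubnP (N.+1 - m)%N; elim: d m => // d IH m md.
have [mN|mN] := ltnP N m; last first.
  rewrite rows_rec big_ltn // [\prod_(_ <= _ < _) _]big_ltn //.
  by apply/top_length_row/IH; lia.
rewrite rows_gt // !big_geq // => p; rewrite ffunE; split=> [|_].
  have [->|//] := eqVneq p 1%g; rewrite invE big1 // => -[i j] /= ij.
  by rewrite !perm1 ltnNge (ltnW ij).
by case: eqP => _; [right|left].
Qed.

End LongestElement.

Section PipeDreamFormula.
Variable N : nat.
Local Notation K := {mpoly int[N.+1]}.
Local Notation T := {ffun 'S_N.+1 -> K}.
Local Notation o j := (inord j : 'I_N.+1).
Implicit Types (f : T) (x : K) (p u : 'S_N.+1) (xi : nat -> K).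

Lemma msym_hecke_op (sg : 'S_N.+1) (a b : 'I_N.+1) x (f g : T) :
  (forall p, g p = msym sg (f p)) ->
  forall p, hecke_op a b (msym sg x) g p = msym sg (hecke_op a b x f p).
Proof.
move=> e p; rewrite !hecke_opE !e; case: ifP => // _.
by rewrite msymD !msymM msymB msym1.
Qed.

Lemma msym_row_op (sg : 'S_N.+1) m x (f g : T) :
  (forall p, g p = msym sg (f p)) ->
  forall p, row_op m (msym sg x) g p = msym sg (row_op m x f p).
Proof.
elim/(@down_ind N): m f g => m mN => [|IH] f g e p.
  by rewrite !row_op_ge.
by rewrite !(row_op_rec _ _ mN); apply/IH/msym_hecke_op.
Qed.

Lemma msym_rows (sg : 'S_N.+1) xi m p :
  rows N (fun k => msym sg (xi k)) m p = msym sg (rows N xi m p).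
Proof.
have [d] := ubnP (N.+1 - m)%N; elim: d m p => // d IH m p md.
have [mN|mN] := ltnP N m; last first.
  by rewrite !(rows_rec _ _ m); apply: msym_row_op => q; apply: IH; lia.
by rewrite !rows_gt // ffunE; case: eqP => _; rewrite ?msym1 ?msym0.
Qed.

Definition pipe_sum u : K := rows N (row_var N) 0 u^-1%g.

(** The product has as many factors as w0 has inversions, so that top_length_rows
    leaves 0 and the product of the variables of all factors; reach_rows excludes 0. *)
Lemma pipe_sum_w0 : pipe_sum (w0 N.+1) = \prod_(i < N.+1) 'X_i ^+ (N.+1 - i.+1).
Proof.
have w0V : ((w0 N.+1)^-1 = w0 N.+1)%g.
  apply/eqP; rewrite eq_invg_mul; apply/eqP/permP => i.
  by rewrite permM !permE rev_ordK.
have [s s0 _] : exists2 s, 0 < signed_coeff (rows N (row_var N) 0) (w0 N.+1)^-1%g s &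
    forall k : 'I_N.+1, (0 <= k)%N -> (raj (w0 N.+1) k <= s k)%N.
  by apply: reach_rows.
have := (top_length_rows (row_var N) 0 (w0 N.+1)).2 (inv_w0 N).
rewrite -{1 2}w0V => -[e|].
  by move: s0; rewrite /signed_coeff e mcoeff0 mulr0 ltxx.
rewrite /pipe_sum => ->; rewrite big_mkord; apply: eq_bigr => i _.
by rewrite /row_var -ltnS ltn_ord inord_val subSS.
Qed.

Lemma one_subX_neq0 k : 1 - row_var N k != 0.
Proof.
apply/eqP => /(congr1 (mcoeff 0%MM)); rewrite mcoeffB mcoeff1 eqxx mcoeff0.
have -> : (row_var N k)@_0 = 0; last by move=> /eqP; rewrite subr0 oner_eq0.
rewrite /row_var; case: ifP => _; last by rewrite mcoeff0.
rewrite mcoeffX; case: eqP => // /(congr1 (@mdeg _)).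
by rewrite mdeg1 mdeg0.
Qed.

Lemma pipe_sum_idivdiff (i j : 'I_N.+1) u : adjacent i j -> (u j < u i)%N ->
  idivdiff i j (pipe_sum u) = pipe_sum (swap_pos i j u).
Proof.
move=> adj desc; have ij := eqP adj; have jN := ltn_ord j.
have iE : o i = i by rewrite inord_val.
have jE : o i.+1 = j by rewrite -ij inord_val.
have p1 : row_var N i = 'X_i by rewrite /row_var iE -ltnS ltn_ord.
have p2 : row_var N i.+1 = 'X_j by rewrite /row_var jE; case: ifP => //; lia.
pose xi' k := msym (tperm i j) (row_var N k).
apply/esym/divdiff_unique; first exact: adjacent_neq.
have := @rows_exchange N _ (row_var N) xi' i 0 u^-1%g.
rewrite /xi' p1 p2 !msymXU tpermL tpermR => /(_ _ isT erefl erefl).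
rewrite iE jE msym_rows right_idemE invgK desc => e.
rewrite msymM msymB msym1 msymXU tpermR -e; first by rewrite /pipe_sum /swap_pos invMg tpermV.
- by lia.
- move=> k ki kj; rewrite /row_var; case: ifP => [kN|]; last by rewrite msym0.
  by rewrite msymXU tpermD // -val_eqE /= inordK //; lia.
- by rewrite -p1 one_subX_neq0.
- by rewrite -p2 one_subX_neq0.
Qed.

Theorem grothendieck_pipe_sum u : grothendieck N.+1 u = pipe_sum u.
Proof.
have := @is_grothendieck_unique N.+1 (grothendieck N.+1) [ffun u => pipe_sum u].
rewrite grothendieckP => /(_ isT) ->; first by rewrite ffunE.
apply/is_grothendieckP; split; first by rewrite ffunE pipe_sum_w0.
by move=> w i j adj; rewrite !ffunE inv_swap_posP // => /(pipe_sum_idivdiff adj).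
Qed.

End PipeDreamFormula.

Theorem grothendieck_coeff_ge_raj n (u : 'S_n) : exists2 s,
  (grothendieck n u)@_s != 0 & forall k, (raj u k <= s k)%N.
Proof.
case: n u => [|N] u.
  exists 0%MM => [|[]//]; have -> : u = w0 0 by apply/permP => -[].
  have /is_grothendieckP[-> _] := grothendieckP 0.
  by rewrite big_ord0 mcoeff1 eqxx.
have [|s s0 sr] := @reach_rows N 0 u; first by [].
exists s => [|k]; last exact: sr.
apply: contraTneq s0; rewrite grothendieck_pipe_sum /signed_coeff => ->.
by rewrite mulr0 ltxx.
Qed.

(** * Partial degrees of Grothendieck polynomials *)

Section GrothendieckSupport.
Variable n : nat.
Local Notation G := (grothendieck n).
Implicit Types (u v w : 'S_n) (i j k : 'I_n) (s t : 'X_{1..n}).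

Lemma grothendieck_ascent u i j : adjacent i j -> (u i < u j)%N ->
  G u = idivdiff i j (G (swap_pos i j u)).
Proof.
move=> adj asc; have /is_grothendieckP[_ GS] := grothendieckP n.
have lt : (Defs.inv (swap_pos i j (swap_pos i j u)) < Defs.inv (swap_pos i j u))%N.
  by rewrite inv_swap_posP // swap_posL swap_posR.
by have := GS _ _ _ adj lt; rewrite swap_posK.
Qed.

(** Induction in the right weak order, downwards from w0. *)
Lemma ascent_ind (P : 'S_n -> Prop) :
  (forall u, (forall i j, adjacent i j -> (u i < u j)%N -> P (swap_pos i j u)) ->
    P u) -> forall u, P u.
Proof.
move=> IH u; have [d] := ubnP (n * n - Defs.inv u)%N; elim: d u => // d IHd u ud.
apply: IH => i j adj asc; apply: IHd.
by have := inv_le (swap_pos i j u); rewrite inv_swap_pos //; lia.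
Qed.

Lemma ascentP u : u = w0 n \/ exists i j, adjacent i j /\ (u i < u j)%N.
Proof.
have [/existsP[[i j]] /= /andP[adj wij]|none] :=
  boolP [exists p, adjacent p.1 p.2 && (u p.1 < u p.2)%N].
  by right; exists i, j.
left; apply: no_ascent_w0 => i j adj.
by move: none; rewrite negb_exists => /forallP/(_ (i, j)) /=; rewrite adj.
Qed.

Lemma grothendieck_staircase u s k : (G u)@_s != 0 -> (s k + k.+1 <= n)%N.
Proof.
elim/ascent_ind: u s k => u IH s k; have [->|[i [j [adj asc]]]] := ascentP u.
  have /is_grothendieckP[-> _] := grothendieckP n.
  have -> : \prod_(i < n) 'X_i ^+ (n - i.+1) =
      'X_[[multinom (n - i.+1)%N | i < n]] :> {mpoly int[n]}.
    by rewrite mpolyXE_id; apply: eq_bigr => i _; rewrite mnmE.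
  rewrite mcoeffX; have [<- _|_] := eqVneq [multinom (n - i.+1)%N | i < n] s; last by rewrite eqxx.
  by rewrite mnmE subnK // ltn_ord.
rewrite (grothendieck_ascent adj asc); have ij := adjacent_neq adj.
have iE := eqP adj; have jn := ltn_ord j.
have bi t : (G (swap_pos i j u))@_t != 0 -> (t i <= (n - j.+1).+1)%N.
  by move=> /(IH _ _ adj asc t i); lia.
have bj t : (G (swap_pos i j u))@_t != 0 -> (t j <= n - j.+1)%N.
  by move=> /(IH _ _ adj asc t j); lia.
have [->|ki] := eqVneq k i; first by move=> /(idivdiff_degL ij bi bj); lia.
have [->|kj] := eqVneq k j; first by move=> /(idivdiff_degR ij bi bj); lia.
have bk t : (G (swap_pos i j u))@_t != 0 -> (t k <= n - k.+1)%N.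
  by move=> /(IH _ _ adj asc t k); lia.
by move=> /(idivdiff_deg_other ij ki kj bk); have := ltn_ord k; lia.
Qed.

Lemma card_records_le u k : (#|records u k| <= n - k)%N.
Proof.
have -> : (n - k = #|[set q : 'I_n | (k <= q)%N]|)%N.
  rewrite cardsE -sum1_card -(big_geq_mkord k n xpredT (fun=> 1%N)).
  by rewrite sum_nat_const_nat muln1.
by apply/subset_leq_card/subsetP => q /recordsP[kq _]; rewrite inE.
Qed.

(** At an ascent k, the degree in x_k is bounded by the degrees in x_k, minus one,
    and in the next variable for u with the ascent switched.  At a descent k, an
    ascent beyond k that does not start at a record from k can be switched without
    losing a record; if there is none, u decreases from k on, k is the only record,
    and the staircase bound suffices. *)
Lemma grothendieck_deg_records u s k : (G u)@_s != 0 ->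
  (s k + #|records u k| <= n - k)%N.
Proof.
elim/ascent_ind: u s k => u IH s k s0; have kn := ltn_ord k.
have stair : records u k = [set k] -> (s k + #|records u k| <= n - k)%N.
  by move=> ->; rewrite cards1; have := grothendieck_staircase k s0; lia.
have [/existsP[j /andP[adj asc]]|none1] :=
    boolP [exists j, adjacent k j && (u k < u j)%N].
  move: s0; rewrite (grothendieck_ascent adj asc); have kj := adjacent_neq adj.
  have kE := eqP adj; have := card_records_ascent adj asc.
  have := card_records_swapL adj asc; have := card_records_swapR adj asc.
  set D := (n - k - #|records u k|)%N => c1 c2 c3.
  have le := card_records_le u k.
  have bi t : (G (swap_pos k j u))@_t != 0 -> (t k <= D.+1)%N.
    by move=> /(IH _ _ adj asc t k); lia.
  have bj t : (G (swap_pos k j u))@_t != 0 -> (t j <= D)%N.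
    by move=> /(IH _ _ adj asc t j); lia.
  by move=> /(idivdiff_degL kj bi bj); lia.
have [/existsP[[i j] /= /and4P[adj asc ki iN]]|none2] :=
    boolP [exists p, [&& adjacent p.1 p.2, (u p.1 < u p.2)%N, (k < p.1)%N &
      p.1 \notin records u k]].
  move: s0; rewrite (grothendieck_ascent adj asc); have ij := adjacent_neq adj.
  have iE := eqP adj; have c := card_records_swap_lt adj asc ki iN.
  have [kNi kNj] : k != i /\ k != j by rewrite -!val_eqE /=; lia.
  have bk t : (G (swap_pos i j u))@_t != 0 ->
      (t k <= n - k - #|records (swap_pos i j u) k|)%N.
    by move=> /(IH _ _ adj asc t k); lia.
  have := card_records_le (swap_pos i j u) k.
  move=> le /(idivdiff_deg_other ij kNi kNj bk); move: c le.
  by move: #|_| #|_| => x y; lia.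
apply: stair; apply: records_decreasing => [j adj|i j adj ki asc].
  have [asc|//] := adjacent_ascent_or u adj.
  by move: none1; rewrite negb_exists => /forallP/(_ j); rewrite adj asc.
move: none2; rewrite negb_exists => /forallP/(_ (i, j)) /=.
by rewrite adj asc ki /= negbK.
Qed.

End GrothendieckSupport.

(** * Top-degree parts *)

Section LeadingTerm.
Variable n : nat.
Local Notation G := (grothendieck n).
Implicit Types (u v w : 'S_n) (i j k : 'I_n) (s t : 'X_{1..n}).

Definition raj_mnm u : 'X_{1..n} := [multinom raj u k | k < n].

Lemma raj_mnm_lis u v : raj_mnm u = raj_mnm v -> forall k, lis u k = lis v k.
Proof.
move=> e k; have := congr1 (fun m : 'X_{1..n} => m k) e; rewrite !mnmE.
by have := raj_lis u k; have := raj_lis v k; lia.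
Qed.

Lemma lis_raj_mnm u v : (forall k, lis u k = lis v k) -> raj_mnm u = raj_mnm v.
Proof. by move=> e; apply/mnmP => k; rewrite !mnmE !rajE e. Qed.

(** At i, u has an ascent such that no longest increasing subsequence from i passes
    through j. *)
Definition skips u i j := adjacent i j && ((lis u j).+1 < lis u i)%N.

Definition tight_from u (m : nat) := forall i j, (m <= i)%N -> ~~ skips u i j.

Lemma last_skip u : tight_from u 0 \/
  exists i j, skips u i j /\ tight_from u i.+1.
Proof.
have [/existsP[i0 P0]|none] := boolP [exists i, [exists j, skips u i j]]; last first.
  left=> i j _; move: none; rewrite negb_exists => /forallP/(_ i).
  by rewrite negb_exists => /forallP/(_ j).
right; have [i /existsP[j sij] imax] :=
  arg_maxnP (P := fun i => [exists j, skips u i j]) (fun i => i : nat) P0.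
exists i, j; split=> // a b ia; apply/negP => sab.
have : (a <= i)%N by apply: imax; apply/existsP; exists b.
by rewrite leqNgt ia.
Qed.

Lemma tight_card_records u k : tight_from u k -> (lis u k <= #|records u k|)%N.
Proof.
move=> tu; apply: card_records_ge_lis => i j adj ki.
by have := tu i j ki; rewrite /skips adj -leqNgt.
Qed.

(** For tight u there are at least lis u k records from k, so that the bound of
    grothendieck_deg_records is at most raj u k. *)
Lemma tight_deg u s k : tight_from u 0 -> (G u)@_s != 0 -> (s k <= raj_mnm u k)%N.
Proof.
move=> tu /(grothendieck_deg_records k) le.
have := @tight_card_records u k (fun i j _ => tu i j isT).
rewrite mnmE; have := raj_lis u k; move: le; move: #|_| => x; lia.
Qed.

Lemma mnm_le_mdeg s t : (forall k, (s k <= t k)%N) -> (mdeg s <= mdeg t)%N.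
Proof. by move=> le; rewrite !mdegE; apply: leq_sum. Qed.

Lemma mnm_le_eq s t : (forall k, (s k <= t k)%N) -> mdeg s = mdeg t -> s = t.
Proof.
move=> le e; have /submK e' : (s <= t)%MM by apply/mnm_lepP.
have := congr1 (@mdeg n) e'; rewrite mdegD e => /eqP.
by rewrite -[X in _ == X]add0n eqn_add2r mdeg_eq0 => /eqP z; rewrite -e' z add0m.
Qed.

Lemma tight_support u s : tight_from u 0 ->
  (G u)@_s != 0 -> mdeg s = mdeg (raj_mnm u) -> s = raj_mnm u.
Proof. by move=> tu s0; apply: mnm_le_eq => k; apply: tight_deg. Qed.

Lemma raj_mnm_skip u i j : skips u i j ->
  [/\ raj_mnm (swap_pos i j u) i = (raj_mnm u j).+1,
      raj_mnm (swap_pos i j u) j = (raj_mnm u i).-1,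
      forall k, k != i -> k != j -> raj_mnm (swap_pos i j u) k = raj_mnm u k,
      (raj_mnm u i <= raj_mnm u j)%N & (0 < raj_mnm u i)%N].
Proof.
case/andP=> adj sk; have E := lis_swap_pos adj sk; have ij := eqP adj.
have := raj_lis u i; have := raj_lis u j.
have := raj_lis (swap_pos i j u) i; have := raj_lis (swap_pos i j u) j.
rewrite !E tpermL tpermR => e1 e2 e3 e4; have jn := ltn_ord j.
have := lis_le u j.
split=> [||k ki kj||]; rewrite !mnmE; try lia.
by rewrite !rajE E tpermD // eq_sym.
Qed.

Lemma mdeg_raj_mnm_skip u i j : skips u i j ->
  mdeg (raj_mnm (swap_pos i j u)) = mdeg (raj_mnm u).
Proof.
move=> sk; have [e1 e2 e3 e4 e5] := raj_mnm_skip sk; case/andP: sk => adj _.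
rewrite -!prefix_sum_total; apply: (prefix_sum_eq adj e3); first by rewrite e1 e2; lia.
by have := ltn_ord j; rewrite (eqP adj); lia.
Qed.

(** For tight u, tight_deg bounds the exponents by those of r, and
    grothendieck_coeff_ge_raj provides a monomial that must then be x^r.  Otherwise
    the last skipped ascent (i, j) is switched.  After position i all is tight, and
    the records of the switched permutation from i are as many as those of u from
    j; this gives the bound on the exponent of x_i that idivdiff_dominates and
    idivdiff_lead require. *)
Theorem grothendieck_leading u : (G u)@_(raj_mnm u) != 0 /\
  forall s, (G u)@_s != 0 -> (mdeg s <= mdeg (raj_mnm u))%N /\
    (mdeg s = mdeg (raj_mnm u) -> dominates s (raj_mnm u)).
Proof.
elim/ascent_ind: u => u IH; have [tu|[i [j [sk tu]]]] := last_skip u.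
  have le s : (G u)@_s != 0 -> (mdeg s <= mdeg (raj_mnm u))%N.
    by move=> s0; apply: mnm_le_mdeg => k; apply: tight_deg.
  split=> [|s s0].
    have [s s0 sr] := grothendieck_coeff_ge_raj u.
    rewrite -(tight_support tu s0) //; apply/eqP; rewrite eqn_leq le // mnm_le_mdeg // => k.
    by rewrite mnmE.
  by split=> [|e k]; [apply: le | rewrite (tight_support tu s0 e)].
have [r'i r'j r'D rij r0] := raj_mnm_skip sk; have dE := mdeg_raj_mnm_skip sk.
have := sk; case/andP => adj lt; have asc := lis_ascent adj (ltnW lt).
have [w0' wle] := IH i j adj asc.
have f_deg s : (G (swap_pos i j u))@_s != 0 -> (mdeg s <= mdeg (raj_mnm u))%N.
  by case/wle; rewrite dE.
have f_dom s : (G (swap_pos i j u))@_s != 0 -> mdeg s = mdeg (raj_mnm u) ->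
    dominates s (raj_mnm (swap_pos i j u)).
  by case/wle; rewrite dE.
have f_i s : (G (swap_pos i j u))@_s != 0 -> (s i <= (raj_mnm u j).+1)%N.
  move=> /(grothendieck_deg_records i); rewrite card_records_swapL //.
  have : (lis u j <= #|records u j|)%N.
    by apply: tight_card_records; rewrite (eqP adj).
  move: #|_| => x; have := raj_lis u j; rewrite mnmE; have := eqP adj.
  by have := ltn_ord j; lia.
rewrite (grothendieck_ascent adj asc); split.
  by rewrite (idivdiff_lead adj rij r0 r'i r'j r'D f_deg f_dom f_i) oppr_eq0.
exact: (idivdiff_dominates adj rij r0 r'i r'j r'D f_deg f_dom f_i).
Qed.

Lemma idivdiff_lin i j (c d : int) (f g : {mpoly int[n]}) : i != j ->
  idivdiff i j (c *: f - d *: g) = c *: idivdiff i j f - d *: idivdiff i j g.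
Proof.
move=> ij; apply/esym/divdiff_unique => //.
have := idivdiffE i j f; have := idivdiffE i j g.
rewrite msymM !msymB msym1 msymXU tpermR !msymZ -!mul_mpolyC.
move: (idivdiff i j f) (idivdiff i j g) => a b eb ea.
rewrite mulrBr !(mulrCA ('X_i - 'X_j)) ea eb.
move: (msym _ f) (msym _ g) ('X_i) ('X_j) => f' g' x y.
by ring.
Qed.

(** Equal rajcodes have the same skipped ascents.  After switching one of them in
    both permutations, some combination of the two polynomials has no term in
    degree |r| or above; its divided difference has none either.  For tight
    permutations both top parts are multiples of the same monomial. *)
Lemma same_raj_proportional u v : raj_mnm u = raj_mnm v ->
  exists c d : int, [/\ c != 0, d != 0 &
    forall t, mdeg t = mdeg (raj_mnm u) -> c * (G u)@_t = d * (G v)@_t].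
Proof.
elim/ascent_ind: u v => u IH v e; have L := raj_mnm_lis e.
have [tu|[i [j [sk _]]]] := last_skip u.
  have tv : tight_from v 0 by move=> i j _; rewrite /skips -!L; apply: tu.
  exists (G v)@_(raj_mnm v), (G u)@_(raj_mnm u); split.
  - by have [] := grothendieck_leading v.
  - by have [] := grothendieck_leading u.
  move=> t dt; have [->|tN] := eqVneq t (raj_mnm u); first by rewrite e mulrC.
  have [->|/(tight_support tu)/(_ dt)] := eqVneq (G u)@_t 0; last by move/eqP: tN.
  have [->|/(tight_support tv)] := eqVneq (G v)@_t 0; first by rewrite !mulr0.
  by rewrite -e => /(_ dt); move/eqP: tN.
have skv : skips v i j by rewrite /skips -!L.
have := sk; case/andP => adj lt; have asc := lis_ascent adj (ltnW lt).
have ltv : ((lis v j).+1 < lis v i)%N by rewrite -!L.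
have ascv := lis_ascent adj (ltnW ltv).
have e' : raj_mnm (swap_pos i j u) = raj_mnm (swap_pos i j v).
  by apply: lis_raj_mnm => k; rewrite !lis_swap_pos.
have [c [d [c0 d0 cd]]] := IH i j adj asc _ e'.
exists c, d; split=> // t dt; apply/eqP; rewrite -subr_eq0 -!mcoeffZ -mcoeffB.
rewrite (grothendieck_ascent adj asc) (grothendieck_ascent adj ascv).
have ij := adjacent_neq adj; rewrite -idivdiff_lin //.
apply/contraT => /(idivdiff_mdeg_lt (d := mdeg (raj_mnm u)) ij).
rewrite dt ltnn; apply=> s; rewrite ltnNge; apply: contraNN => le.
rewrite mcoeffB !mcoeffZ; apply/eqP.
have := le; rewrite leq_eqVlt => /orP[/eqP es|ls].
  by apply/eqP; rewrite subr_eq0 cd // mdeg_raj_mnm_skip.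
have z w : mdeg (raj_mnm w) = mdeg (raj_mnm u) -> (G w)@_s = 0.
  move=> ew; have [//|/(grothendieck_leading w).2[]] := eqVneq (G w)@_s 0.
  by rewrite ew leqNgt ls.
by rewrite !z ?mulr0 ?subrr // -?e' mdeg_raj_mnm_skip.
Qed.

Lemma mcoeff_top_part (f : {mpoly int[n]}) m :
  (top_part f)@_m = if mdeg m == mpoly_deg f then f@_m else 0.
Proof.
rewrite /top_part pihomogE; under eq_bigr do rewrite -mul_mpolyC.
rewrite raddf_sum /=; under eq_bigr do rewrite mcoeffCM mcoeffX.
have [mf|mf] := boolP (m \in msupp f); last first.
  rewrite memN_msupp_eq0 // if_same big_seq_cond big1 // => s /andP[sf _].
  by rewrite (_ : (s == m) = false) ?mulr0 //; apply: contraNF mf => /eqP <-.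
rewrite big_mkcond (bigD1_seq m) ?msupp_uniq //= eqxx mulr1 big1 ?addr0 //.
by move=> s /negbTE ->; rewrite mulr0 if_same.
Qed.

Lemma mpoly_deg_eq (f : {mpoly int[n]}) m : f@_m != 0 ->
  (forall s, f@_s != 0 -> (mdeg s <= mdeg m)%N) -> mpoly_deg f = mdeg m.
Proof.
move=> m0 le; rewrite /mpoly_deg; suff -> : msize f = (mdeg m).+1 by [].
apply/eqP; rewrite eqn_leq msize_mdeg_lt ?mcoeff_msupp // andbT msizeE.
apply/bigmax_leqP_seq => s; rewrite mcoeff_msupp => s0 _.
exact: le.
Qed.

Lemma mcoeff_cm_poly u : exists2 e : int, e != 0 &
  forall m, (cm_poly u)@_m = if mdeg m == mdeg (raj_mnm u) then e * (G u)@_m else 0.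
Proof.
rewrite /cm_poly; set e := (-1) ^ _; exists e.
  by rewrite expfz_neq0 // oppr_eq0 oner_eq0.
move=> m; have e0 : e != 0 by rewrite expfz_neq0 // oppr_eq0 oner_eq0.
have [r0 le] := grothendieck_leading u.
rewrite mcoeff_top_part (@mpoly_deg_eq _ (raj_mnm u)) ?mcoeffZ ?mulf_neq0 //.
by move=> s; rewrite mcoeffZ mulf_eq0 (negbTE e0) => /le[].
Qed.

Lemma rajcode_raj_mnm u v : rajcode u = rajcode v <-> raj_mnm u = raj_mnm v.
Proof.
split=> [e|e].
  by apply/mnmP => k; rewrite !mnmE; have := congr1 (fun x => tnth x k) e; rewrite !tnth_mktuple.
apply: eq_from_tnth => k; rewrite !tnth_mktuple.
by have := congr1 (fun m : 'X_{1..n} => m k) e; rewrite !mnmE.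
Qed.

End LeadingTerm.

Theorem mainTheorem5 (n : nat) (u v : 'S_n) :
  (exists c : rat, c != 0 /\
     map_mpoly (intr : int -> rat) (cm_poly u) =
     c *: map_mpoly (intr : int -> rat) (cm_poly v))
  <-> rajcode u = rajcode v.
Proof.
have [eu eu0 cu] := mcoeff_cm_poly u; have [ev ev0 cv] := mcoeff_cm_poly v.
have ru : (cm_poly u)@_(raj_mnm u) != 0.
  by rewrite cu eqxx mulf_neq0 //; have [] := grothendieck_leading u.
have rv : (cm_poly v)@_(raj_mnm v) != 0.
  by rewrite cv eqxx mulf_neq0 //; have [] := grothendieck_leading v.
have dom (w : 'S_n) s : (exists2 e : int, e != 0 & forall m, (cm_poly w)@_m =
      if mdeg m == mdeg (raj_mnm w) then e * (grothendieck n w)@_m else 0) ->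
    (cm_poly w)@_s != 0 -> dominates s (raj_mnm w).
  case=> e _ ->; have [ds|_] := eqVneq (mdeg s) (mdeg (raj_mnm w)); last by rewrite eqxx.
  rewrite mulf_eq0 negb_or => /andP[_ /(grothendieck_leading w).2[_]]; exact.
split=> [[c [c0 e]]|/rajcode_raj_mnm e].
  have eqc s : ((cm_poly u)@_s)%:~R = c * ((cm_poly v)@_s)%:~R.
    by have := congr1 (mcoeff s) e; rewrite mcoeffZ !mcoeff_map_mpoly.
  have eq0 s : ((cm_poly u)@_s == 0) = ((cm_poly v)@_s == 0).
    by rewrite -(intr_eq0 rat) eqc mulf_eq0 (negbTE c0) intr_eq0.
  apply/rajcode_raj_mnm/dominates_anti.
    by apply: dom (mcoeff_cm_poly v) _; rewrite -eq0.
  by apply: dom (mcoeff_cm_poly u) _; rewrite eq0.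
have [a [b [a0 b0 ab]]] := same_raj_proportional e.
have aQ : (a%:~R : rat) != 0 by rewrite intr_eq0.
have euQ : (eu%:~R : rat) != 0 by rewrite intr_eq0.
have evQ : (ev%:~R : rat) != 0 by rewrite intr_eq0.
have bQ : (b%:~R : rat) != 0 by rewrite intr_eq0.
(* cm_poly u and cm_poly v are eu and ev times top parts in the ratio b to a. *)
exists (eu%:~R * b%:~R / (a%:~R * ev%:~R)); split.
  by rewrite !mulf_neq0 // invr_eq0 mulf_neq0.
apply/mpolyP => m; rewrite mcoeffZ !mcoeff_map_mpoly /= cu cv -e.
case: eqP => [dm|_]; last by rewrite mulr0.
have := congr1 (fun z : int => z%:~R : rat) (ab m dm).
rewrite !rmorphM /=; move: ((grothendieck n u)@_m) ((grothendieck n v)@_m) => x y xy.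
apply: (mulfI aQ); rewrite mulrCA xy; field.
by rewrite aQ evQ.
Qed.
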